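(* Let $\Omega\subset\Phi(\mathbf M)$ be a diffiety of codimension $n\ge 1$, let $\Omega_*$ be a good filtration of $\Omega$, and let $\mathcal H=\Omega^\perp$. Then there exists an ordinary basis $Z_1,\ldots,Z_n$ of the $\mathcal F$-module $\mathcal H$ (with respect to $\Omega_*$), i.e. a basis such that for all sufficiently large $l$ and all $i=0,\ldots,n-1$ the multiplication mapping $Z_{i+1}:\mathcal M(i)_l\to\mathcal M(i)_{l+1}$ is injective.
   Context: Everything is local and $C^\infty$. $\mathbf M$ is a manifold modelled on $\mathbb R^\infty$, with local coordinates $h^1,h^2,\ldots$; $\mathcal F=\mathcal F(\mathbf M)$ is the ring of smooth functions each depending on finitely many coordinates; $\Phi=\Phi(\mathbf M)$ is the $\mathcal F$-module of 1-forms $\sum f^i\,dg^i$ (finite sums, $f^i,g^i\in\mathcal F$); $\mathcal T=\mathcal T(\mathbf M)$ is the $\mathcal F$-module of vector fields $\sum z^i\partial/\partial h^i$ (infinite sums, $z^i\in\mathcal F$ arbitrary); $\mathcal L_Z$ is the Lie derivative. For a submodule $\Omega\subset\Phi$, $\Omega^\perp=\{Z\in\mathcal T:\omega(Z)=0\text{ for all }\omega\in\Omega\}$. For a submodule $\Theta\subset\Phi$, $\mathcal L_{\mathcal H}\Theta$ is the submodule generated by all $\mathcal L_Z\vartheta$ ($Z\in\mathcal H$, $\vartheta\in\Theta$). A diffiety is a submodule $\Omega\subset\Phi$ of finite codimension $n$ which, with $\mathcal H=\Omega^\perp$, admits a good filtration $\Omega_*:\Omega_0\subset\Omega_1\subset\cdots\subset\Omega=\bigcup_l\Omega_l$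 by finite-dimensional (finite rank) submodules, i.e. $\mathcal L_{\mathcal H}\Omega_l\subset\Omega_{l+1}$ for all $l$ and $\Omega_l+\mathcal L_{\mathcal H}\Omega_l=\Omega_{l+1}$ for all large $l$. Then $[\mathcal H,\mathcal H]\subset\mathcal H$ and $\mathcal H$ has rank $n$. Put $\mathcal M=\mathcal M_0\oplus\mathcal M_1\oplus\cdots$, $\mathcal M_l=\Omega_l/\Omega_{l-1}$, $\Omega_{-1}=0$. Each $Z\in\mathcal H$ acts $\mathcal F$-linearly by $Z[\omega]=[\mathcal L_Z\omega]\in\mathcal M_{l+1}$ for $[\omega]\in\mathcal M_l$; these actions commute, so $\mathcal M$ is a graded module over $\mathcal A=\mathcal F\oplus\mathcal H\oplus(\mathcal H\odot\mathcal H)\oplus\cdots$, the symmetric (polynomial) $\mathcal F$-algebra over $\mathcal H$. For a basis $Z_1,\ldots,Z_n$ of $\mathcal H$ let $\mathcal A(i)\subset\mathcal A$ be the ideal generated by $Z_1,\ldots,Z_i$ ($\mathcal A(0)=0$) and $\mathcal M(i)=\mathcal M/\mathcal A(i)\mathcal M$, with graded components $\mathcal M(i)_l=\mathcal M_l/(\mathcal A(i)\mathcal M\cap\mathcal M_l)$. Standing postulate: all $\mathcal F$-modules and $\mathcal A$-modules under consideration are assumed (locally) to possess bases (finite $\mathcal A$-generation in the $\mathcal A$-case), so that results of commutative algebra over the field $\mathbb R$, valid at a fixed point $\mathbf P\in\mathbf M$ (where $\mathcal F$ is replaced by $\mathbb R$), extend locally. *)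

(* Defs.v *)
From HB Require Import structures.
From mathcomp Require Import all_boot all_order all_algebra.
From mathcomp Require Import generic_quotient ring_quotient.
From mathcomp Require Import all_classical all_reals.
From mathcomp Require Import topology normedtype derive.

Set Implicit Arguments.
Unset Strict Implicit.
Unset Printing Implicit Defensive.

Import Order.TTheory GRing.Theory Num.Theory.
Import numFieldNormedType.Exports.

Local Open Scope classical_set_scope.
Local Open Scope quotient_scope.
Local Open Scope ring_scope.

(* The model space R^oo: sequences of reals with the product topology, whose
   basic open sets are the cylinders, restricting finitely many coordinates. *)
Notation Rinfty R := {ptws nat -> R}.

Section SmoothFunctions.
Variable R : realType.
Implicit Types (f g : Rinfty R -> R) (U : set (Rinfty R)) (x y P : Rinfty R).

Definition move i x (t : R) : Rinfty R := @dfwith nat (fun=> R) x i t.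

Definition line i f x : R -> R := fun t => f (move i x t).

Definition partial i f : Rinfty R -> R := fun x => derive1 (line i f x) (x i).

Fixpoint class_C k U f : Prop :=
  (forall x, U x -> {for x, continuous f}) /\
  (if k is k'.+1 then
     forall i, (forall x, U x -> derivable (line i f x) (x i) 1) /\
               class_C k' U (partial i f)
   else True).

Definition class_Coo U f := forall k, class_C k U f.

Definition finitely_many_coordinates U f :=
  exists m, forall x y, U x -> U y ->
    (forall i, (i < m)%N -> x i = y i) -> f x = f y.

Definition smooth_at P f :=
  exists U, [/\ open_nbhs P U, class_Coo U f & finitely_many_coordinates U f].

Lemma move_id i x : move i x (x i) = x.
Proof. by apply/funext => j; rewrite /move; case: dfwithP. Qed.

Lemma line_id i f x : line i f x (x i) = f x.
Proof. by rewrite /line move_id. Qed.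

Lemma line_nbhs i x U : open U -> U x -> \forall t \near x i, U (move i x t).
Proof.
move=> oU Ux; have Ux' : nbhs x U by apply: open_nbhs_nbhs; split.
have := @dfwith_continuous nat (fun=> R) x i (x i).
by move/(_ U); apply; rewrite -/(move i x (x i)) move_id.
Qed.

Lemma class_C_eq k U f g : open U -> (forall x, U x -> f x = g x) ->
  class_C k U f -> class_C k U g.
Proof.
move=> oU; elim: k f g => [|k IHk] f g fg /= [cf df]; split.
- move=> x Ux; have fgx : \near x, f x = g x.
    by apply: (filterS fg); apply: open_nbhs_nbhs; split.
  rewrite /prop_for /continuous_at -(fg x Ux).
  exact: cvg_trans (near_eq_cvg fgx) (cf x Ux).
- by [].
- move=> x Ux; have fgx : \near x, f x = g x.
    by apply: (filterS fg); apply: open_nbhs_nbhs; split.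
  rewrite /prop_for /continuous_at -(fg x Ux).
  exact: cvg_trans (near_eq_cvg fgx) (cf x Ux).
- have fgl i x : U x -> {near x i, line i f x =1 line i g x}.
    by move=> Ux; apply: filterS (line_nbhs i oU Ux) => t; apply: fg.
  move=> i; have [dfi Cfi] := df i; split.
    by move=> x Ux; apply: near_eq_derivable (fgl i x Ux) (dfi x Ux).
  apply: IHk Cfi => x Ux; rewrite /partial !derive1E.
  by apply: near_eq_derive; apply: fgl.
Qed.

Lemma class_C_subset k U V f : V `<=` U -> class_C k U f -> class_C k V f.
Proof.
move=> VU; elim: k f => [|k IHk] f /= [cf df]; split=> //.
- by move=> x /VU; apply: cf.
- by move=> x /VU; apply: cf.
- by move=> i; have [dfi Cfi] := df i; split; [move=> x /VU/dfi|apply: IHk].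
Qed.

Lemma class_CW k U f : class_C k.+1 U f -> class_C k U f.
Proof.
elim: k f => [|k IHk] f [cf df]; split=> //.
by move=> i; have [? ?] := df i; split=> //; apply: IHk.
Qed.

Lemma class_C_cst k U (c : R) : class_C k U (fun=> c).
Proof.
elim: k c => [|k IHk] c; split=> //; try by move=> x _; apply: cst_continuous.
move=> i; split; first by move=> x _; apply: derivable_cst.
suff -> : partial i (fun=> c) = fun=> 0 by apply: IHk.
by apply/funext => x; rewrite /partial derive1E derive_cst.
Qed.

Lemma class_CB k U f g : open U ->
  class_C k U f -> class_C k U g -> class_C k U (f - g).
Proof.
move=> oU; elim: k f g => [|k IHk] f g [cf df] [cg dg]; split=> //;
  try by move=> x Ux; apply: continuousB; [apply: cf|apply: cg].
move=> i; have [dfi Cfi] := df i; have [dgi Cgi] := dg i; split.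
  by move=> x Ux; apply: derivableB; [apply: dfi|apply: dgi].
apply: class_C_eq oU _ (IHk _ _ Cfi Cgi) => x Ux.
rewrite /partial [in RHS]derive1E.
have -> : line i (f - g) x = line i f x - line i g x by [].
rewrite deriveB; [|exact: dfi|exact: dgi].
by rewrite -!derive1E.
Qed.

Lemma class_CD k U f g : open U ->
  class_C k U f -> class_C k U g -> class_C k U (f + g).
Proof.
move=> oU Cf Cg; have -> : f + g = f - ((fun=> 0) - g).
  by rewrite [X in X - g](_ : _ = 0) // sub0r opprK.
by apply: class_CB => //; apply: class_CB => //; apply: class_C_cst.
Qed.

Lemma class_CM k U f g : open U ->
  class_C k U f -> class_C k U g -> class_C k U (f * g).
Proof.
move=> oU; elim: k f g => [|k IHk] f g Cf Cg.
  have [cf _] := Cf; have [cg _] := Cg; split=> //.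
  by move=> x Ux; apply: continuousM; [apply: cf|apply: cg].
have [cf df] := Cf; have [cg dg] := Cg; split.
  by move=> x Ux; apply: continuousM; [apply: cf|apply: cg].
move=> i; have [dfi Cfi] := df i; have [dgi Cgi] := dg i; split.
  by move=> x Ux; apply: derivableM; [apply: dfi|apply: dgi].
apply: (@class_C_eq _ _ (f * partial i g + g * partial i f)) => //.
  move=> x Ux; rewrite /partial [in RHS]derive1E.
  have -> : line i (f * g) x = line i f x * line i g x by [].
  rewrite deriveM; [|exact: dfi|exact: dgi].
  by rewrite !line_id -!derive1E.
by apply: class_CD => //; apply: IHk => //; exact: class_CW.
Qed.

Lemma smooth_at_cst P (c : R) : smooth_at P (fun=> c).
Proof.
exists setT; split; last by exists 0%N.
  by split=> //; exact: openT.
by move=> k; exact: class_C_cst.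
Qed.

Lemma smooth_atI P f g : smooth_at P f -> smooth_at P g ->
  exists U m, [/\ open_nbhs P U, class_Coo U f, class_Coo U g &
    forall x y, U x -> U y -> (forall i, (i < m)%N -> x i = y i) ->
      f x = f y /\ g x = g y].
Proof.
move=> [U [oU Cf [m fm]]] [V [oV Cg [p gp]]]; exists (U `&` V), (maxn m p).
split; first exact: open_nbhsI.
- by move=> k; apply: class_C_subset (Cf k); apply: subIsetl.
- by move=> k; apply: class_C_subset (Cg k); apply: subIsetr.
- move=> x y [Ux Vx] [Uy Vy] xy; split.
    by apply: fm => // i im; apply: xy; rewrite leq_max im.
  by apply: gp => // i im; apply: xy; rewrite leq_max im orbT.
Qed.

Lemma smooth_atB P f g : smooth_at P f -> smooth_at P g -> smooth_at P (f - g).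
Proof.
move=> sf sg; have [U [m [[oU PU] Cf Cg fg]]] := smooth_atI sf sg.
exists U; split=> //; first by move=> k; apply: class_CB.
by exists m => x y Ux Uy xy; have [e1 e2] := fg x y Ux Uy xy; congr (_ - _).
Qed.

Lemma smooth_atM P f g : smooth_at P f -> smooth_at P g -> smooth_at P (f * g).
Proof.
move=> sf sg; have [U [m [[oU PU] Cf Cg fg]]] := smooth_atI sf sg.
exists U; split=> //; first by move=> k; apply: class_CM.
by exists m => x y Ux Uy xy; have [e1 e2] := fg x y Ux Uy xy; congr (_ * _).
Qed.

Lemma smooth_at_partial P i f : smooth_at P f -> smooth_at P (partial i f).
Proof.
move=> [U [[oU PU] Cf [m fm]]]; exists U; split=> //.
  by move=> k; have [_ /(_ i)[]] := Cf k.+1.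
exists (maxn m i.+1) => x y Ux Uy xy.
have xyi : x i = y i by apply: xy; rewrite leq_max ltnSn orbT.
rewrite /partial !derive1E -xyi; apply: near_eq_derive.
have Uyi := line_nbhs i oU Uy; rewrite -xyi in Uyi.
apply: filterS2 (line_nbhs i oU Ux) Uyi => t Uxt Uyt.
apply: fm => // j; rewrite /move; case: (dfwithP x t j) => [|k ik] km.
  by rewrite dfwithin.
by rewrite dfwithout // xy // leq_max km.
Qed.

End SmoothFunctions.

(* The theory is local, so the manifold is replaced by its germ at a point P
   of the model space: F is the ring of germs at P of smooth functions, each
   depending on finitely many coordinates, and a module that locally has a
   basis is a free module over F. *)
Section Germs.
Variables (R : realType) (P : Rinfty R).

Definition is_smooth : {pred Rinfty R -> R} := fun f => `[< smooth_at P f >].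

Fact is_smooth_subring : subring_closed is_smooth.
Proof.
split=> [|f g /asboolP sf /asboolP sg|f g /asboolP sf /asboolP sg];
  apply/asboolP.
- exact: smooth_at_cst.
- exact: smooth_atB.
- exact: smooth_atM.
Qed.

HB.instance Definition _ :=
  GRing.isSubringClosed.Build (Rinfty R -> R) is_smooth is_smooth_subring.

Record smooth := Smooth { fun_of_smooth :> Rinfty R -> R;
                          smoothP : fun_of_smooth \in is_smooth }.

HB.instance Definition _ := [isSub for fun_of_smooth].
HB.instance Definition _ := [Choice of smooth by <:].
HB.instance Definition _ :=
  [SubChoice_isSubComNzRing of smooth by <:].

Definition vanish_near : {pred smooth} :=
  fun f => `[< \forall x \near P, f x = 0 >].

Fact vanish_near_ideal : idealr_closed vanish_near.
Proof.
split.
- by apply/asboolP; apply: filterE.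
- apply/negP => /asboolP /nbhs_singleton /eqP.
  by apply/negP; exact: oner_neq0.
- move=> a f g /asboolP f0 /asboolP g0; apply/asboolP.
  apply: filterS2 f0 g0 => x fx gx.
  by rewrite -[LHS]/(a x * f x + g x) fx gx mulr0 addr0.
Qed.

HB.instance Definition _ :=
  isIdealr.Build smooth vanish_near vanish_near_ideal.

Definition germ := {ideal_quot vanish_near}.

HB.instance Definition _ := GRing.ComNzRing.on germ.

Fact partial_is_smooth i (f : smooth) : partial i f \in is_smooth.
Proof.
by case: f => f /= /asboolP sf; apply/asboolP; apply: smooth_at_partial.
Qed.

Definition smooth_partial i (f : smooth) : smooth :=
  Smooth (partial_is_smooth i f).

Definition germ_partial i (f : germ) : germ :=
  \pi_germ (smooth_partial i (repr f)).

Lemma germ_partial_pi i (f : smooth) :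
  germ_partial i (\pi_germ f) = \pi_germ (smooth_partial i f).
Proof.
have germP (g h : smooth) :
    (\forall x \near P, g x = h x) <-> \pi_germ g = \pi_germ h.
  split=> [gh|/eqP].
    apply/eqP; rewrite -Quotient.idealrBE; apply/asboolP.
    by apply: filterS gh => x gh; rewrite -[LHS]/(g x - h x) gh subrr.
  rewrite -Quotient.idealrBE => /asboolP; apply: filterS => x.
  by rewrite -[X in X = _]/(g x - h x) => /eqP; rewrite subr_eq0 => /eqP.
have /germP := reprK (\pi_germ f).
rewrite /prop_near1 nbhsE => -[U [oU PU] fU].
apply/germP; have : nbhs P U by apply: open_nbhs_nbhs; split.
apply: filterS => x Ux.
rewrite /= /partial !derive1E; apply: near_eq_derive.
by apply: filterS (line_nbhs i oU Ux) => t /fU.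
Qed.

End Germs.

Section Modules.
Variables (F : comNzRingType) (V : lmodType F).
Implicit Types N S : set V.

Definition submodule N := submod_closed (fun v => v \in N).

Definition generated S : set V := smallest submodule S.

(* e is a basis of the quotient module N / N', for submodules N' of N. *)
Definition quotient_basis N N' r (e : 'I_r -> V) :=
  [/\ forall i, N (e i),
      forall v, N v -> exists a : 'I_r -> F, N' (v - \sum_i a i *: e i) &
      forall a : 'I_r -> F, N' (\sum_i a i *: e i) -> forall i, a i = 0].

Definition quotient_rank N N' r := exists e : 'I_r -> V, quotient_basis N N' e.

Definition basis N r (e : 'I_r -> V) := quotient_basis N [set 0] e.

Definition finite_rank N := exists r, quotient_rank N [set 0] r.

End Modules.

(* Every finite sum of forms f dg is a unique finite sum of forms a_i dh^i, so
   that the module Phi is free on dh^0, dh^1, ...  It is encoded as the free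
   module {poly germ P}: the form \sum_i a_i dh^i is the polynomial with
   coefficients a_i.  The multiplication of polynomials plays no role. *)
Notation one_form P := {poly germ P}.

(* The vector field \sum_i z^i d/dh^i, an arbitrary infinite sum, is the
   sequence of its coefficients z^i. *)
Notation vector_field P := (nat -> (germ P)^o).

Section Diffieties.
Variables (R : realType) (P : Rinfty R).
Implicit Types (f g : germ P) (w t : one_form P) (Z : vector_field P).
Implicit Types (Omega Theta : set (one_form P)) (H : set (vector_field P)).
Implicit Types (Omegas : nat -> set (one_form P)).

Definition dh i : one_form P := 'X^i.

(* Only finitely many partial derivatives of a germ are nonzero. *)
Definition differential f : one_form P :=
  \sum_(k \in [set: nat]) germ_partial k f *: dh k.

Definition contraction w Z : germ P := \sum_(i < size w) w`_i * Z i.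

Definition lie_function Z f : germ P := contraction (differential f) Z.

(* L_Z (a_i dh^i) = (Z a_i) dh^i + a_i d(Z h^i), where Z h^i = z^i. *)
Definition lie Z w : one_form P :=
  \sum_(i < size w) (lie_function Z w`_i *: dh i + w`_i *: differential (Z i)).

Definition annihilator Omega : set (vector_field P) :=
  [set Z | forall w, Omega w -> contraction w Z = 0].

Definition lie_module H Theta : set (one_form P) :=
  generated [set lie Z t | Z in H & t in Theta].

Definition good_filtration Omega Omegas :=
  let H := annihilator Omega in
  [/\ forall l, submodule (Omegas l) /\ finite_rank (Omegas l),
      forall l, Omegas l `<=` Omegas l.+1,
      Omega = \bigcup_l Omegas l,
      forall l, lie_module H (Omegas l) `<=` Omegas l.+1 &
      exists l0, forall l, (l0 <= l)%N ->
        [set u + v | u in Omegas l & v in lie_module H (Omegas l)]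
        = Omegas l.+1].

Definition codimension Omega n := quotient_rank [set: one_form P] Omega n.

Definition diffiety n Omega :=
  [/\ submodule Omega, codimension Omega n &
      exists Omegas, good_filtration Omega Omegas].

Definition previous Omegas l : set (one_form P) :=
  if l is k.+1 then Omegas k else [set 0].

(* The standing postulate that the components M_l of the graded module M are
   free. *)
Definition free_components Omegas :=
  forall l, exists r, quotient_rank (Omegas l) (previous Omegas l) r.

(* The graded module M = \bigoplus_l Omega_l / Omega_(l-1) is the quotient of
   graded_cover by graded_null. *)
Definition graded_cover Omegas : set (nat -> one_form P) :=
  [set u | finite_set [set l | u l != 0] /\ forall l, Omegas l (u l)].

Definition graded_null Omegas : set (nat -> one_form P) :=
  graded_cover (previous Omegas).

Definition homogeneous l w : nat -> one_form P :=
  fun k => if k == l then w else 0.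

Definition graded_act Z (u : nat -> one_form P) : nat -> one_form P :=
  fun l => if l is k.+1 then lie Z (u k) else 0.

(* The A-submodules of M, seen as their inverse images in graded_cover.  Since
   the algebra A is generated by F and H, they are the F-submodules that are
   stable under the action of H. *)
Definition A_submodule H Omegas (N : set (nat -> one_form P)) :=
  [/\ submodule N, graded_null Omegas `<=` N, N `<=` graded_cover Omegas &
      forall Z u, H Z -> N u -> N (graded_act Z u)].

(* A(i)M is the A-submodule generated by Z_1 M, ..., Z_i M, which are
   Z 0, ..., Z (i - 1) in the numbering of 'I_n. *)
Definition A_ideal_mul H Omegas n (Z : 'I_n -> vector_field P) (i : nat) :
    set (nat -> one_form P) :=
  smallest (A_submodule H Omegas)
    [set v | exists (j : 'I_n) u,
               [/\ (j < i)%N, graded_cover Omegas u & v = graded_act (Z j) u]].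

(* For w and w' in Omega_l: w and w' have the same class in
   M(i)_l = M_l / (A(i)M `&` M_l). *)
Definition eq_component H Omegas n (Z : 'I_n -> vector_field P) (i l : nat)
    w w' :=
  A_ideal_mul H Omegas Z i (homogeneous l (w - w')).

Definition ordinary_basis Omega Omegas n (Z : 'I_n -> vector_field P) :=
  let H := annihilator Omega in
  basis H Z /\
  exists l0, forall l, (l0 <= l)%N -> forall i : 'I_n,
    forall w w', Omegas l w -> Omegas l w' ->
      eq_component H Omegas Z i l.+1 (lie (Z i) w) (lie (Z i) w') ->
      eq_component H Omegas Z i l w w'.

End Diffieties.

(* Main.v *)
From HB Require Import structures.
From mathcomp Require Import all_boot all_order all_algebra.
From mathcomp Require Import generic_quotient ring_quotient.
From mathcomp Require Import all_classical all_reals topology.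
From mathcomp Require Import normedtype derive.
Require Import Defs.

Set Implicit Arguments.
Unset Strict Implicit.
Unset Printing Implicit Defensive.
Import Order.TTheory GRing.Theory Num.Theory.
Import numFieldNormedType.Exports.
Local Open Scope classical_set_scope.
Local Open Scope quotient_scope.
Local Open Scope ring_scope.

(** The ring F of germs is local: a germ that does not vanish at P is
    invertible, so that its residue field is R, by evaluation at P.  The
    annihilator of Omega has a basis W_1, ..., W_n, dual to a basis of
    Phi / Omega.  For Z in the annihilator and w in Omega, L_Z w is F-linear in
    Z, and L_Z (f w) differs from f L_Z w by a multiple of w; moreover
    L_Z L_W - L_W L_Z is the Lie derivative along [Z, W], which again
    annihilates Omega.  On the components Omega_l / Omega_(l-1) the Lie
    derivatives are therefore F-linear and commute.  Evaluation at P turns them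
    into a finitely generated graded module over the polynomial ring
    R[z_1, ..., z_n].

    Over R the theorem is the existence of a filter-regular sequence of linear
    forms.  The module is Noetherian by the basis theorem
    ([graded_basis_theorem]).  A graded submodule N that is not everything can
    be enlarged to the elements that are sent into N by every linear form of
    some subspace, chosen of maximal dimension among the annihilators of nonzero
    homogeneous elements modulo N; a linear form outside this subspace is
    injective on the enlargement modulo N, and if the subspace contains all the
    linear forms, then the enlargement equals N in high degrees
    ([generically_injective_extend]).  The ascending chain condition shows that
    every linear form outside finitely many hyperplanes is injective in high
    degrees ([generic_injective]).  A filter-regular sequence is found by
    applying this successively to the quotients by the linear forms already
    chosen ([exists_filter_regular]).

    The constant coefficients of these linear forms give combinations
    Z_1, ..., Z_n of the W_i.  Going back to F uses that a map between free
    modules over a local ring that is injective at the closed point is injective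
    with a free cokernel ([lift_injective], [cokernel_free]): by induction on i
    the components M(i)_l are free for large l, and injectivity at P lifts
    ([exists_ordinary_basis]).

    Quotient modules are never formed.  An element of a quotient M / B is a
    representative in M, everything is stated modulo the submodule B, and the
    operators are additive on the ambient space, but linear and commuting only
    modulo B.  The Lie derivatives of forms have exactly this property. *)

(** * Submodules as sets of vectors *)

Section Submodules.
Variables (F : comNzRingType) (V : lmodType F).
Implicit Types N B : set V.

Lemma submoduleP N : submodule N <->
  N 0 /\ forall a u v, N u -> N v -> N (a *: u + v).
Proof.
split=> [[N0 NZ]|[N0 NZ]]; first split.
- by move: N0; rewrite in_setE.
- by move=> a u v Nu Nv; have := NZ a u v; rewrite !in_setE; apply.
- split; first by rewrite in_setE.
  by move=> a u v; rewrite !in_setE; apply: NZ.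
Qed.

Section Closure.
Variables (N : set V) (subN : submodule N).

Lemma submodule0 : N 0. Proof. by have /submoduleP[] := subN. Qed.

Lemma submoduleZD a u v : N u -> N v -> N (a *: u + v).
Proof. by have /submoduleP[_] := subN; apply. Qed.

Lemma submoduleD u v : N u -> N v -> N (u + v).
Proof. by rewrite -[u in u + v]scale1r; apply: submoduleZD. Qed.

Lemma submoduleZ a u : N u -> N (a *: u).
Proof. by move=> Nu; rewrite -[_ *: _]addr0; apply: submoduleZD submodule0. Qed.

Lemma submoduleN u : N u -> N (- u).
Proof. by rewrite -scaleN1r; apply: submoduleZ. Qed.

Lemma submoduleB u v : N u -> N v -> N (u - v).
Proof. by move=> Nu /submoduleN; apply: submoduleD. Qed.

Lemma submodule_sum I (r : seq I) (Q : pred I) (f : I -> V) :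
  (forall i, Q i -> N (f i)) -> N (\sum_(i <- r | Q i) f i).
Proof.
by move=> Nf; elim/big_ind: _ => //; [exact: submodule0 | exact: submoduleD].
Qed.

Lemma submodule_mod u v : N (u - v) -> N v -> N u.
Proof. by move=> Nuv Nv; rewrite -(subrK v u); apply: submoduleD. Qed.

Lemma submodule_modC u v : N (v - u) -> N v -> N u.
Proof. by move=> /submoduleN; rewrite opprB; apply: submodule_mod. Qed.

End Closure.

(** The preimage in the ambient module of the submodule of V / B that is
    generated by the images y_i N.  The representatives p are part of the
    definition because the y_i are linear only modulo B. *)
Definition sum_images (I : finType) (Q : pred I) (y : I -> V -> V) N B : set V :=
  [set v | exists2 p : I -> V, forall i, N (p i) &
                               B (v - \sum_(i | Q i) y i (p i))].

Section SumImages.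
Variables (I : finType) (Q : pred I) (y : I -> V -> V) (N B : set V).
Hypotheses (subN : submodule N) (subB : submodule B).
Hypothesis yD : forall i u v, y i (u + v) = y i u + y i v.
Hypothesis yZ : forall i a v, N v -> B (y i (a *: v) - a *: y i v).

Lemma sum_images_submodule : submodule (sum_images Q y N B).
Proof.
apply/submoduleP; split.
  exists (fun=> 0) => [i|]; first exact: submodule0.
  rewrite big1 ?subrr => [|i _]; first exact: submodule0.
  by apply: (addrI (y i 0)); rewrite -yD !addr0.
move=> a u v [p Np Bp] [q Nq Bq].
exists (fun i => a *: p i + q i) => [i|]; first exact: submoduleZD.
have -> : a *: u + v - \sum_(i | Q i) y i (a *: p i + q i) =
  (a *: (u - \sum_(i | Q i) y i (p i)) + (v - \sum_(i | Q i) y i (q i))) -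
  \sum_(i | Q i) (y i (a *: p i) - a *: y i (p i)).
  rewrite (eq_bigr (fun i => y i (a *: p i) + y i (q i))) => [|i _ //].
  rewrite sumrB big_split scalerBr /= -scaler_sumr [in RHS]opprB.
  by rewrite [RHS]addrAC [X in _ = X + _]addrA subrK addrACA -opprD.
apply: submoduleB => //; first exact: submoduleZD.
by apply: submodule_sum => // i _; apply: yZ.
Qed.

Lemma sum_images_base : B `<=` sum_images Q y N B.
Proof.
move=> v Bv; exists (fun=> 0) => [i|]; first exact: submodule0.
rewrite big1 ?subr0 // => i _.
by apply: (addrI (y i 0)); rewrite -yD !addr0.
Qed.

Lemma sum_images_image i v : Q i -> N v -> sum_images Q y N B (y i v).
Proof.
move=> Qi Nv; exists (fun j => if j == i then v else 0) => [j|].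
  by case: eqP => // _; apply: submodule0.
rewrite (bigD1 i) //= eqxx big1 ?addr0 ?subrr => [|j /andP[_ /negPf->]].
  exact: submodule0.
by apply: (addrI (y j 0)); rewrite -yD !addr0.
Qed.

End SumImages.

Lemma sum_images_sub (I : finType) (Q : pred I) (y : I -> V -> V) N B T :
  submodule T -> B `<=` T -> (forall i v, Q i -> N v -> T (y i v)) ->
  sum_images Q y N B `<=` T.
Proof.
move=> subT BT yT v [p Np Bp].
apply: (submodule_mod subT (BT _ Bp)).
by apply: submodule_sum => // i Qi; apply: yT.
Qed.

End Submodules.

(** * Subspaces and ranks *)

Section MaximalRank.
Variables (K : fieldType) (r : nat).

(** Subspaces of K^r given by a predicate are handled through matrices whose
    rows satisfy it; one of maximal rank spans. *)
Lemma max_rank (Q : 'M[K]_r -> Prop) X0 : Q X0 ->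
  exists2 X, Q X & forall Y, Q Y -> (\rank Y <= \rank X)%N.
Proof.
move=> QX0.
have ex : exists k, `[< exists2 X, Q X & \rank X = k >].
  by exists (\rank X0); apply/asboolP; exists X0.
have ub k : `[< exists2 X, Q X & \rank X = k >] -> (k <= r)%N.
  by move=> /asboolP[X _ <-]; apply: rank_leq_row.
have [k /asboolP[X QX <-] kmax] := ex_maxnP ex ub.
by exists X => // Y QY; apply: kmax; apply/asboolP; exists Y.
Qed.

Lemma subspace_submx (S : set 'rV[K]_r) m (X : 'M[K]_(m, r)) :
  submodule S -> (forall i, S (row i X)) -> forall v, (v <= X)%MS -> S v.
Proof.
move=> subS SX v /submxP[D ->]; rewrite mulmx_sum_row.
by apply: submodule_sum => // i _; apply: submoduleZ.
Qed.

Lemma subspace_adds (S : set 'rV[K]_r) (X : 'M[K]_r) (v : 'rV[K]_r) :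
  submodule S -> (forall i, S (row i X)) -> S v ->
  forall i, S (row i (X + v)%MS).
Proof.
move=> subS SX Sv i; have /sub_addsmxP[[u1 u2] /= ->] := row_sub i (X + v)%MS.
apply: submoduleD => //; first exact: (subspace_submx subS SX (submxMl _ _)).
have Sv' j : S (row j v) by rewrite (ord1 j) row_id.
exact: (subspace_submx subS Sv' (submxMl _ _)).
Qed.

Lemma rank_adds_submx (X : 'M[K]_r) (v : 'rV[K]_r) :
  (\rank (X + v)%MS <= \rank X)%N -> (v <= X)%MS.
Proof.
move=> le; have := mxrank_leqif_sup (addsmxSl X v).
move=> /geq_leqif; rewrite le => /esym le'.
exact: submx_trans (addsmxSr X v) le'.
Qed.

(** A matrix of maximal rank with all its rows in one member of the chain spans
    the union of the chain. *)
Lemma subspace_chain (S : nat -> set 'rV[K]_r) :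
  (forall i, submodule (S i)) -> (forall i, S i `<=` S i.+1) ->
  exists i0, forall i, S i `<=` S i0.
Proof.
move=> subS Sup.
have Sle i j : (i <= j)%N -> S i `<=` S j.
  by move=> /subnK <-; elim: (j - i)%N => // k IH v /IH; apply: Sup.
have [|X [i0 SX] Xmax] := @max_rank (fun X => exists i, forall j, S i (row j X)) 0.
  by exists 0%N => j; rewrite row0; apply: submodule0.
exists i0 => i v Sv; apply: (subspace_submx (subS i0) SX).
apply: rank_adds_submx; apply: Xmax; exists (maxn i i0).
apply: subspace_adds => //; first by move=> j; apply: Sle (leq_maxr _ _) _ (SX j).
exact: Sle (leq_maxl _ _) _ Sv.
Qed.

End MaximalRank.

(** * Graded modules over a polynomial ring, as subquotients *)

Section Graded.
Variables (K : fieldType) (F : comNzRingType) (cst : {rmorphism K -> F}).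
Variables (V : lmodType F) (n : nat).

(** The graded module whose component of degree l is M l / B l; the row vector c
    acts as the linear form with coefficients c.  For forms and Lie derivatives
    the defects measured here lie in the previous step of a filtration, hence
    the requirements modulo B. *)
Record graded_module (M B : nat -> set V) (z : 'rV[K]_n -> V -> V) : Prop :=
  GradedModule {
    graded_M : forall l, submodule (M l);
    graded_B : forall l, submodule (B l);
    graded_BM : forall l, B l `<=` M l;
    graded_zM : forall l c v, M l v -> M l.+1 (z c v);
    graded_zB : forall l c v, B l v -> B l.+1 (z c v);
    graded_zD : forall c u v, z c (u + v) = z c u + z c v;
    graded_zZ : forall l c a v, M l v -> B l.+1 (z c (a *: v) - a *: z c v);
    graded_zC : forall l c d v,
      M l v -> B l.+2 (z c (z d v) - z d (z c v));
    graded_zL : forall l k c d v,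
      M l v -> B l.+1 (z (k *: c + d) v - (cst k *: z c v + z d v)) }.

(** A ring of germs is not Noetherian: the chain condition comes from M l / B l
    being a finite-dimensional vector space over the residue field. *)
Definition graded_acc (M B : nat -> set V) := forall l (N : nat -> set V),
  (forall i, submodule (N i)) -> (forall i, B l `<=` N i) ->
  (forall i, N i `<=` M l) -> (forall i, N i `<=` N i.+1) ->
  exists i0, forall i, N i `<=` N i0.

Definition coord_vec (j : 'I_n) : 'rV[K]_n := delta_mx 0 j.

Definition graded_fg (M B : nat -> set V) (z : 'rV[K]_n -> V -> V) :=
  exists l0, forall l, (l0 <= l)%N ->
    M l.+1 `<=` sum_images predT (fun j : 'I_n => z (coord_vec j)) (M l) (B l.+1).

Section Theory.
Variables (M B : nat -> set V) (z : 'rV[K]_n -> V -> V).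
Hypothesis gm : graded_module M B z.
Implicit Types (N C : nat -> set V) (c d : 'rV[K]_n).

Let subM := graded_M gm.
Let subB := graded_B gm.
Let BM := graded_BM gm.
Let zM := graded_zM gm.
Let zB := graded_zB gm.
Let zD := graded_zD gm.
Let zZ := graded_zZ gm.
Let zC := graded_zC gm.
Let zL := graded_zL gm.

Lemma act0 c : z c 0 = 0.
Proof. by apply: (addrI (z c 0)); rewrite -zD !addr0. Qed.

Lemma actN c v : z c (- v) = - z c v.
Proof. by apply: (addrI (z c v)); rewrite -zD !subrr act0. Qed.

Lemma act_sub c u v : z c (u - v) = z c u - z c v.
Proof. by rewrite zD actN. Qed.

Lemma act_sum c I (r : seq I) (Q : pred I) (f : I -> V) :
  z c (\sum_(i <- r | Q i) f i) = \sum_(i <- r | Q i) z c (f i).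
Proof. exact: (big_morph (z c) (zD c) (act0 c)). Qed.

(** The graded submodules of M / B, as their inverse images in M. *)
Record graded_sub N : Prop := GradedSub {
  sub_submodule : forall l, submodule (N l);
  sub_base : forall l, B l `<=` N l;
  sub_top : forall l, N l `<=` M l;
  sub_stable : forall l c v, N l v -> N l.+1 (z c v) }.

Lemma graded_sub_base : graded_sub B.
Proof. by split=> // l v. Qed.

Lemma graded_sub_top : graded_sub M.
Proof. by split=> // l v. Qed.

Lemma graded_sub_lin N l (subN : graded_sub N) k c d v : M l v ->
  N l.+1 (cst k *: z c v + z d v) -> N l.+1 (z (k *: c + d) v).
Proof.
move=> Mv; apply: (submodule_mod (sub_submodule subN _)).
by apply: (sub_base subN); apply: zL.
Qed.

Section Images.
Variables (I : finType) (Q : pred I) (g : I -> 'rV[K]_n).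
Variables (N : nat -> set V) (C : set V) (l : nat).
Hypotheses (subN : submodule (N l)) (NM : N l `<=` M l).
Hypotheses (subC : submodule C) (BC : B l.+1 `<=` C).

Lemma images_submodule : submodule (sum_images Q (fun i => z (g i)) (N l) C).
Proof. by apply: sum_images_submodule => // i a v /NM Mv; apply/BC/zZ. Qed.

Lemma images_base : C `<=` sum_images Q (fun i => z (g i)) (N l) C.
Proof. by apply: sum_images_base. Qed.

Lemma images_image i v :
  Q i -> N l v -> sum_images Q (fun i => z (g i)) (N l) C (z (g i) v).
Proof.
by move=> Qi Nv; apply: (@sum_images_image _ _ _ Q (fun i => z (g i))).
Qed.

End Images.

(** The inverse image of C + sum_i z_(g i) M: the operators raise the degree by
    one, so that nothing is added in degree 0. *)
Definition add_images (I : finType) (Q : pred I) (g : I -> 'rV[K]_n) C l :=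
  if l is k.+1 then sum_images Q (fun i => z (g i)) (M k) (C l) else C 0.

Section AddImages.
Variables (I : finType) (Q : pred I) (g : I -> 'rV[K]_n) (C : nat -> set V).
Hypothesis subC : graded_sub C.

Lemma add_images_base l : C l `<=` add_images Q g C l.
Proof.
case: l => [//|l]; apply: images_base => //.
Qed.

Lemma graded_sub_add_images : graded_sub (add_images Q g C).
Proof.
have sC := sub_submodule subC; have BC := sub_base subC.
have sA l : submodule (add_images Q g C l).
  by case: l => [|l]; [apply: sC | apply: (@images_submodule _ Q g M)].
split=> // l.
- by apply: subset_trans (@add_images_base l).
- case: l => [|l]; first exact: (sub_top subC).
  apply: sum_images_sub => //; first exact: (sub_top subC).
  by move=> i v _; apply: zM.
- move=> c v; case: l => [|l].
    by move=> /(sub_stable subC c); apply: add_images_base.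
  move=> [p Mp Cp].
  apply: (submodule_mod (sA _) (v := z c (\sum_(i | Q i) z (g i) (p i)))).
    by rewrite -act_sub; apply: add_images_base; apply: (sub_stable subC c Cp).
  rewrite act_sum; apply: submodule_sum => // i Qi.
  apply: (submodule_mod (sA _) (v := z (g i) (z c (p i)))).
    by apply: add_images_base; apply: BC; apply: zC.
  by apply: images_image => //; apply: zM.
Qed.

End AddImages.

(** N / C is finitely generated over the polynomial ring in the first k
    variables; each degree satisfies the chain condition, so that it suffices
    to generate in high degrees. *)
Definition finitely_generated k C N := exists l0, forall l, (l0 <= l)%N ->
  N l.+1 `<=` sum_images (fun j : 'I_n => (j < k)%N) (fun j => z (coord_vec j))
                         (N l) (C l.+1).

Definition noetherian k C := forall N, graded_sub N ->
  (forall l, C l `<=` N l) -> finitely_generated k C N.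

Hypothesis acc : graded_acc M B.

(** The union of the chain is generated in degrees at most some d; once the chain
    is stationary in these finitely many degrees it is stationary. *)
Lemma noetherian_chain k C (S : nat -> nat -> set V) : noetherian k C ->
  (forall i, graded_sub (S i)) -> (forall i l, C l `<=` S i l) ->
  (forall i l, S i l `<=` S i.+1 l) ->
  exists i0, forall i l, S i l `<=` S i0 l.
Proof.
move=> noC subS CS Sup.
have Sle l i j : (i <= j)%N -> S i l `<=` S j l.
  by move=> /subnK <-; elim: (j - i)%N => // m IH v /IH; apply: Sup.
pose U l : set V := [set v | exists i, S i l v].
have subU : graded_sub U.
  split=> [l|l v Bv|l v [i]|l c v [i Sv]].
  - apply/submoduleP; split.
      by exists 0%N; apply: submodule0; apply: sub_submodule (subS 0%N) l.
    move=> a u v [i Su] [j Sv]; exists (maxn i j).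
    apply: submoduleZD; first exact: sub_submodule (subS _) l.
      exact: Sle (leq_maxl _ _) _ Su.
    exact: Sle (leq_maxr _ _) _ Sv.
  - by exists 0%N; apply: (sub_base (subS 0%N)).
  - exact: (sub_top (subS i)).
  - by exists i; apply: (sub_stable (subS i)).
have [|d dU] := noC U subU; first by move=> l v Cv; exists 0%N; apply: CS.
have [i0 lowS] : exists i0, forall i l, (l <= d)%N -> S i l `<=` S i0 l.
  elim: d {dU} => [|d [i0 IH]].
    have [||||i0 Si0] := @acc 0 (fun i => S i 0%N).
    - by move=> i; apply: sub_submodule (subS i) _.
    - by move=> i; apply: sub_base (subS i) _.
    - by move=> i; apply: sub_top (subS i) _.
    - by move=> i; apply: Sup.
    - by exists i0 => i l; rewrite leqn0 => /eqP ->; apply: Si0.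
  have [||||i1 Si1] := @acc d.+1 (fun i => S i d.+1).
  - by move=> i; apply: sub_submodule (subS i) _.
  - by move=> i; apply: sub_base (subS i) _.
  - by move=> i; apply: sub_top (subS i) _.
  - by move=> i; apply: Sup.
  exists (maxn i0 i1) => i l; rewrite leq_eqVlt => /orP[/eqP -> v /Si1|].
    by apply: Sle; apply: leq_maxr.
  by rewrite ltnS => /IH{}IH v /IH; apply: Sle; apply: leq_maxl.
exists i0 => i l v Sv; have: U l v by exists i.
elim: l v {i Sv} => [|l IH] v; first by move=> [i]; apply: lowS.
case: (leqP d l) => [dl|ld] Uv; last by have [i] := Uv; apply: lowS.
move/(_ l dl v Uv): dU; apply: sum_images_sub => {Uv}.
- exact: sub_submodule (subS _) _.
- exact: CS.
- by move=> j u _ /IH; apply: (sub_stable (subS i0)).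
Qed.

(** * The basis theorem *)

Section Hilbert.
Variables (k : nat) (lt_kn : (k < n)%N) (C : nat -> set V).
Hypothesis subC : graded_sub C.
Let xi := Ordinal lt_kn.
Let x := z (coord_vec xi).
Let C' := add_images (pred1 xi) (fun j => coord_vec j) C.
Let subC' : graded_sub C' := graded_sub_add_images _ _ subC.

Lemma iter_actD i u v : iter i x (u + v) = iter i x u + iter i x v.
Proof. by elim: i => //= i ->; apply: zD. Qed.

Lemma iter_act0 i : iter i x 0 = 0.
Proof. by elim: i => //= i ->; apply: act0. Qed.

Lemma iter_act_sub i u v : iter i x (u - v) = iter i x u - iter i x v.
Proof.
by apply: (addIr (iter i x v)); rewrite -iter_actD !subrK.
Qed.

Lemma iter_act_sum i I (r : seq I) (Q : pred I) (f : I -> V) :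
  iter i x (\sum_(j <- r | Q j) f j) = \sum_(j <- r | Q j) iter i x (f j).
Proof. exact: (big_morph (iter i x) (iter_actD i) (iter_act0 i)). Qed.

Lemma iter_act_stable N i l v : graded_sub N -> N l v -> N (i + l)%N (iter i x v).
Proof. by move=> sN Nv; elim: i => //= i; apply: (sub_stable sN). Qed.

Lemma iter_actZ i l a v : M l v ->
  B (i + l)%N (iter i x (a *: v) - a *: iter i x v).
Proof.
move=> Mv; elim: i => [|i IH] /=; first by rewrite subrr; apply: submodule0.
apply: (submodule_mod (subB _) (v := x (a *: iter i x v) - a *: x (iter i x v))).
  rewrite opprB addrA subrK -act_sub; exact: zB.
by apply: zZ; apply: iter_act_stable graded_sub_top _.
Qed.

Lemma iter_actC i l c v : M l v ->
  B (i + l).+1 (iter i x (z c v) - z c (iter i x v)).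
Proof.
move=> Mv; elim: i => [|i IH] /=; first by rewrite subrr; apply: submodule0.
apply: (submodule_mod (subB _) (v := x (z c (iter i x v)) - z c (x (iter i x v)))).
  rewrite opprB addrA subrK -act_sub; exact: zB.
by apply: zC; apply: iter_act_stable graded_sub_top _.
Qed.

(** The colon module (N : x^i), enlarged by C + x M.  Its image in M / (C + x M)
    plays the role of the module of leading coefficients of order i. *)
Definition colon N i l : set V :=
  [set v | exists2 q, M l q /\ N (i + l)%N (iter i x q) & C' l (v - q)].

Lemma graded_sub_colon N i : graded_sub N -> graded_sub (colon N i).
Proof.
move=> sN; have sNl := sub_submodule sN; have sC'l := sub_submodule subC'.
split=> l.
- apply/submoduleP; split.
    exists 0; last by rewrite subr0; apply: submodule0.
    by rewrite iter_act0; split; apply: submodule0.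
  move=> a u v [p [Mp Np] Cp] [q [Mq Nq] Cq]; exists (a *: p + q).
    split; first exact: submoduleZD.
    rewrite iter_actD; apply: submoduleD => //.
    apply: (submodule_mod (sNl _) _ (submoduleZ (sNl _) a Np)).
    by apply: (sub_base sN); apply: iter_actZ.
  have -> : a *: u + v - (a *: p + q) = a *: (u - p) + (v - q).
    by rewrite opprD addrACA scalerBr.
  exact: submoduleZD.
- move=> v Bv; exists 0; last by rewrite subr0; apply: sub_base subC' _ _ Bv.
  by rewrite iter_act0; split; apply: submodule0.
- by move=> v [q [Mq _] /(sub_top subC') /(submodule_mod (subM _))]; apply.
- move=> c v [q [Mq Nq] Cq]; exists (z c q); last first.
    by rewrite -act_sub; apply: sub_stable.
  split; first exact: zM.
  rewrite addnS; apply: (submodule_mod (sNl _) _ (sub_stable sN c Nq)).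
  by apply: (sub_base sN); apply: iter_actC.
Qed.

Lemma base_colon N i l : graded_sub N -> C' l `<=` colon N i l.
Proof.
move=> sN v Cv; exists 0; last by rewrite subr0.
rewrite iter_act0; split; apply: submodule0 => //.
exact: sub_submodule sN _.
Qed.

Lemma colon_chain N i l : graded_sub N -> colon N i l `<=` colon N i.+1 l.
Proof.
by move=> sN v [q [Mq Nq] Cq]; exists q => //; split=> //; apply: (sub_stable sN).
Qed.

Lemma iter_add_images i t v : C' t v ->
  (C (i + t)%N (iter i x v)) \/
  (exists t' m, [/\ t = t'.+1, M t' m & C (i + t)%N (iter i x v - iter i.+1 x m)]).
Proof.
case: t => [|t].
  by move=> Cv; left; apply: iter_act_stable.
move=> [p Mp]; rewrite big_pred1_eq => Cp; right; exists t, (p xi); split=> //.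
by rewrite iterSr -iter_act_sub; apply: iter_act_stable.
Qed.

(** The induction step of Hilbert's theorem, for x = z_k.  The colon modules
    (N : x^i) ascend modulo C + x M, where k variables suffice, and become
    stationary at some i0.  An element of N is reduced modulo ever higher powers
    of x: as long as i is at most i0, the finitely many modules (N : x^i) are
    generated by their elements of one degree less when the degree is large;
    beyond i0, an element x^i q with x^i0 q in N is x times an element of N. *)
Lemma noetherian_step : noetherian k C' -> noetherian k.+1 C.
Proof.
move=> noC' N sN CN.
have sNl := sub_submodule sN.
have [i0 i0P] : exists i0, forall i l, colon N i l `<=` colon N i0 l.
  apply: (noetherian_chain noC').
  - by move=> i; apply: graded_sub_colon.
  - by move=> i l; apply: base_colon.
  - by move=> i l; apply: colon_chain.
have [D DP] : exists D, forall i, (i <= i0)%N -> forall l, (D <= l)%N ->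
    colon N i l.+1 `<=` sum_images (fun j : 'I_n => (j < k)%N)
                          (fun j => z (coord_vec j)) (colon N i l) (C' l.+1).
  have colon_fg i : finitely_generated k C' (colon N i).
    by apply: noC' => [|l]; [apply: graded_sub_colon | apply: base_colon].
  elim: i0 {i0P} => [|i0 [D DP]].
    have [D DP] := colon_fg 0%N; exists D => i; rewrite leqn0 => /eqP ->.
    exact: DP.
  have [D' DP'] := colon_fg i0.+1; exists (maxn D D') => i.
  rewrite leq_eqVlt => /orP[/eqP -> l lD|lt_i l lD].
    by apply: DP'; apply: leq_trans lD; apply: leq_maxr.
  by apply: DP => //; apply: leq_trans lD; apply: leq_maxl.
exists (D + i0)%N => l lD.
set G := sum_images _ _ _ _.
have sG : submodule G.
  apply: images_submodule => //; first exact: sub_top sN _.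
    exact: sub_submodule subC _.
  exact: sub_base subC _.
have CG : C l.+1 `<=` G by apply: images_base => //; exact: sub_submodule subC _.
have BG : B l.+1 `<=` G by apply: subset_trans CG; apply: sub_base subC _.
have GN : G `<=` N l.+1.
  by apply: sum_images_sub => // j v _; apply: sub_stable.
have zG (j : 'I_n) v : (j < k.+1)%N -> N l v -> G (z (coord_vec j) v).
  move=> jk Nv; apply: (@images_image _ _ (fun j => coord_vec j) N) => //.
  exact: sub_submodule subC _.
have step t i m : (i + t = l.+1)%N -> M t m -> N l.+1 (iter i x m) ->
    G (iter i x m) \/
    exists t' m', [/\ t = t'.+1, M t' m' & G (iter i x m - iter i.+1 x m')].
  move=> it Mm Nm.
  have colm : colon N i t m.
    exists m; last first.
      by rewrite subrr; apply: submodule0; exact: sub_submodule subC' _.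
    by rewrite it.
  (* The remainder m - q is in C + x M, so it only contributes to C and to the
     next power of x. *)
  suff [q Gq] : exists2 q, G (iter i x q) & C' t (m - q).
    move=> /(iter_add_images i); rewrite it => -[Cmq|[t' [m' [-> Mm' Cmq]]]].
      left; rewrite -(subrK q m) iter_actD; apply: submoduleD => //.
      exact: CG.
    right; exists t', m'; split=> //.
    rewrite -(subrK q m) iter_actD addrAC.
    by apply: submoduleD => //; apply: CG.
  case: (ltnP i0 i) => [lt_i|le_i].
    have [q [Mq Nq] Cq] := i0P i t m colm; exists q => //.
    have [s def_i] : exists s, i = (s + i0).+1.
      by exists (i - i0.+1)%N; rewrite -addnS subnK.
    rewrite def_i iterS iterD; apply: zG => //=.
    have -> : l = (s + (i0 + t))%N.
      by move: it; rewrite def_i addSn => -[<-]; rewrite addnA.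
    exact: iter_act_stable.
  case: t it Mm Nm colm => [|t] it Mm Nm colm.
    have : (l.+1 <= i0)%N by rewrite -it addn0.
    by rewrite ltnNge (leq_trans _ lD) // leq_addl.
  have it' : (i + t = l)%N by move: it; rewrite addnS => -[].
  have Dt : (D <= t)%N.
    rewrite -(leq_add2r i0); apply: leq_trans lD _.
    by rewrite -it' addnC leq_add2l.
  have [p colp Cp] := DP i le_i t Dt m colm.
  pose q' (j : 'I_n) := projT1 (cid2 (colp j)).
  have q'P j : (M t (q' j) /\ N (i + t)%N (iter i x (q' j))) /\ C' t (p j - q' j).
    by rewrite /q'; case: cid2.
  exists (\sum_(j < n | (j < k)%N) z (coord_vec j) (q' j)).
    rewrite iter_act_sum; apply: submodule_sum => // j jk.
    have [[Mq Nq] _] := q'P j.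
    apply: (submodule_mod sG (v := z (coord_vec j) (iter i x (q' j)))).
      by apply: BG; rewrite -it'; apply: iter_actC.
    by apply: zG; [apply: ltnW | rewrite -it'].
  have sC't : submodule (C' t.+1) by apply: sub_submodule subC' _.
  apply: (submodule_mod sC't
    (v := \sum_(j < n | (j < k)%N) z (coord_vec j) (p j - q' j))).
    rewrite -addrA -opprD -big_split /=.
    by under eq_bigr => j do rewrite -zD addrC subrK.
  apply: submodule_sum => // j _; have [_ Cpq] := q'P j.
  exact: (sub_stable subC').
(* In degree 0 the second alternative of step cannot occur. *)
have main t : forall i m, (i + t = l.+1)%N -> M t m -> N l.+1 (iter i x m) ->
    G (iter i x m).
  elim: t => [|t IH] i m it Mm Nm.
    by have [//|[t' [m' []]]] := step 0%N i m it Mm Nm.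
  have [//|[_ [m' [[<-] Mm' Gm]]]] := step t.+1 i m it Mm Nm.
  apply: (submodule_mod sG Gm); apply: IH => //; first by rewrite addSnnS.
  by apply: (submodule_modC (sNl _) (v := iter i x m)) => //; apply: GN.
by move=> v Nv; apply: (main l.+1 0%N) => //; apply: (sub_top sN).
Qed.

End Hilbert.

Lemma graded_basis_theorem k C : (k <= n)%N -> graded_sub C ->
  finitely_generated k C M -> noetherian k C.
Proof.
elim: k C => [|k IH] C lt_kn subC [d dM].
  move=> N sN CN; exists d => l dl v /(sub_top sN)/dM -/(_ dl).
  move=> [p Mp]; rewrite big_pred0 // subr0 => Cv.
  by apply: images_base => //; apply: sub_submodule sN _.
have subC' :=
  graded_sub_add_images (pred1 (Ordinal lt_kn)) (fun j => coord_vec j) subC.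
apply: (@noetherian_step _ lt_kn) => //.
apply: IH => //; first exact: ltnW.
exists d => l /dM lM v /lM{lM}.
have sC' := sub_submodule subC'; have BC' := sub_base subC'.
have sI := images_submodule (fun j : 'I_n => (j < k)%N) (fun j => coord_vec j)
  (subM l) (@subset_refl _ _) (sC' l.+1) (BC' l.+1).
apply: sum_images_sub => //.
  apply: subset_trans; last exact: images_base.
  exact: add_images_base.
move=> j u; rewrite ltnS leq_eqVlt => /orP[/eqP jk|jk] Mu; last first.
  exact: (@images_image _ _ (fun j => coord_vec j) M).
apply: images_base => //.
have -> : j = Ordinal lt_kn by apply: val_inj.
apply: (@images_image _ (pred1 _) (fun j => coord_vec j) M) => //=.
exact: sub_submodule subC _.
Qed.

Lemma graded_noetherian C : graded_fg M B z -> graded_sub C -> noetherian n C.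
Proof.
move=> [d dM] subC; apply: graded_basis_theorem => //.
exists d => l /dM lM v /lM [p Mp Bp]; exists p => //.
under eq_bigl => j do rewrite ltn_ord.
exact: (sub_base subC).
Qed.

End Theory.
End Graded.

(** * General linear forms *)

Lemma exists_non_root (K : numDomainType) (p : {poly K}) :
  p != 0 -> exists t, p.[t] != 0.
Proof.
move=> p0; apply: contrapT => /forallNP rootp.
have := @max_poly_roots _ p [seq i%:R | i <- iota 0 (size p)] p0.
rewrite size_map size_iota ltnn => /(_ _ _)/notF; apply.
  by apply/allP => t _; apply/negPn/negP; apply: rootp.
by rewrite map_inj_uniq ?iota_uniq // => i j /eqP; rewrite eqr_nat => /eqP.
Qed.

(** A hyperplane with equation a meets the moment curve (1, t, t^2, ...) in the
    roots of the polynomial with coefficients a, and K is infinite. *)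
Lemma avoid_hyperplanes (K : numFieldType) n (s : seq 'cV[K]_n) :
  0 \notin s -> exists c : 'rV[K]_n, forall a, a \in s -> c *m a != 0.
Proof.
move=> s0.
pose p (a : 'cV[K]_n) :=
  \poly_(i < n) (if insub i is Some j then a j 0 else 0).
have pE (a : 'cV[K]_n) t : (p a).[t] = ((\row_j t ^+ j) *m a) 0 0.
  rewrite /p horner_poly mxE; apply: eq_bigr => i _.
  by rewrite valK mxE mulrC.
have p0 a : a \in s -> p a != 0.
  move=> sa; apply/eqP => pa0; case/negP: s0; suff <- : a = 0 by [].
  apply/colP => j; rewrite mxE; have := congr1 (fun q : {poly K} => q`_j) pa0.
  by rewrite coef_poly ltn_ord coef0 valK.
have [|t nt] := @exists_non_root _ (\prod_(a <- s) p a).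
  by rewrite prodf_seq_neq0; apply/allP => a /p0.
exists (\row_j t ^+ j) => a sa; apply: contraNneq nt => ca.
by rewrite horner_prod (big_rem a) //= pE ca mxE mul0r.
Qed.

Section FilterRegular.
Variables (K : numFieldType) (F : comNzRingType) (cst : {rmorphism K -> F}).
Variables (V : lmodType F) (n : nat).
Variables (M B : nat -> set V) (z : 'rV[K]_n -> V -> V).
Hypothesis gm : graded_module cst M B z.
Hypotheses (acc : graded_acc M B) (fg : graded_fg M B z).
Implicit Types (N C : nat -> set V) (c d : 'rV[K]_n).

Let subM := graded_M gm.
Let subB := graded_B gm.
Let zM := graded_zM gm.
Let zD := graded_zD gm.
Let zC := graded_zC gm.
Let zL := graded_zL gm.

Definition killing_forms N l v : set 'rV[K]_n := [set c | N l.+1 (z c v)].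

Lemma killing_forms_subspace N l v : graded_sub M B z N -> M l v ->
  submodule (killing_forms N l v).
Proof.
move=> sN Mv; have sNl := sub_submodule sN.
have kL a c d : killing_forms N l v c -> killing_forms N l v d ->
    killing_forms N l v (a *: c + d).
  move=> Nc Nd; apply: (graded_sub_lin gm sN Mv).
  by apply: submoduleD => //; apply: submoduleZ.
apply/submoduleP; split=> //.
have: B l.+1 (z ((-1) *: 0 + 0) v - (cst (-1) *: z 0 v + z 0 v)) by apply: zL.
(* z 0 v is in B because 0 = (-1) 0 + 0. *)
rewrite scaler0 addr0 rmorphN rmorph1 scaleN1r addNr subr0 => Bz.
exact: (sub_base sN).
Qed.

Definition killed_by N m (X : 'M[K]_(m, n)) l : set V :=
  [set v | M l v /\ forall i, N l.+1 (z (row i X) v)].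

Lemma graded_sub_killed_by N m (X : 'M[K]_(m, n)) :
  graded_sub M B z N -> graded_sub M B z (killed_by N X).
Proof.
move=> sN; have sNl := sub_submodule sN; have BN := sub_base sN.
split=> l.
- apply/submoduleP; split.
    by split=> [|i]; rewrite ?(act0 gm); apply: submodule0.
  move=> a u v [Mu Nu] [Mv Nv]; split=> [|i]; first exact: submoduleZD.
  rewrite zD; apply: submoduleD => //.
  apply: (submodule_mod (sNl _) _ (submoduleZ (sNl _) a (Nu i))).
  by apply: BN; apply: (graded_zZ gm).
- move=> v Bv; split=> [|i]; first exact: (graded_BM gm).
  by apply: BN; apply: (graded_zB gm).
- by move=> v [].
- move=> c v [Mv Nv]; split=> [|i]; first exact: zM.
  apply: (submodule_mod (sNl _) _ (sub_stable sN c (Nv i))).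
  by apply: BN; apply: zC.
Qed.

Lemma sub_killed_by N m (X : 'M[K]_(m, n)) l :
  graded_sub M B z N -> N l `<=` killed_by N X l.
Proof.
move=> sN v Nv; split; first exact: (sub_top sN).
by move=> i; apply: (sub_stable sN).
Qed.

(** The excluded hyperplanes are given by their equations, the columns in s. *)
Definition generically_injective C N :=
  exists2 s : seq 'cV[K]_n, 0 \notin s &
  exists l0, forall c, (forall a, a \in s -> c *m a != 0) ->
    forall l, (l0 <= l)%N -> forall v, N l v -> C l.+1 (z c v) -> C l v.

(** Among the pairs (v, X) where v is homogeneous and not in N, and the rows of X
    span a space of linear forms that annihilate v modulo N, take one with X of
    maximal rank, and let N' consist of the elements killed modulo N by the rows
    of X.  By maximality, a linear form outside the row space of X is injective
    on N' / N: excluding one hyperplane through this row space suffices.  If the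
    row space is everything, then all the variables kill N' / N, which is
    finitely generated, hence zero in high degrees. *)
Lemma generically_injective_extend C N : graded_sub M B z C ->
  graded_sub M B z N -> (forall l, C l `<=` N l) ->
  generically_injective C N -> (exists l v, M l v /\ ~ N l v) ->
  exists N', [/\ graded_sub M B z N', forall l, N l `<=` N' l,
    generically_injective C N' & exists l v, N' l v /\ ~ N l v].
Proof.
move=> sC sN CN [s s0 [l0 sP]] [l1 [v1 [Mv1 Nv1]]].
have sNl := sub_submodule sN.
pose ann (X : 'M[K]_n) := exists l v, [/\ M l v, ~ N l v & killed_by N X l v].
have [|X [l [v [Mv Nv Xv]]] Xmax] := @max_rank _ _ ann 0.
  exists l1, v1; split=> //; split=> // i; rewrite row0.
  exact: (submodule0 (killing_forms_subspace sN Mv1)).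
have sX := graded_sub_killed_by X sN.
have kX l' v' c : M l' v' -> ~ N l' v' -> killed_by N X l' v' ->
    N l'.+1 (z c v') -> (c <= X)%MS.
  move=> Mv' Nv' Xv' Ncv; apply: rank_adds_submx; apply: Xmax.
  exists l', v'; split=> //; split=> //.
  apply: (subspace_adds (killing_forms_subspace sN Mv')) => //.
  by have [_] := Xv'.
exists (killed_by N X); split=> //; first by move=> k; apply: sub_killed_by.
  have [[a aX a0]|Xfull] := pselect (exists2 a : 'cV[K]_n, X *m a = 0 & a != 0).
    exists (a :: s); first by rewrite inE eq_sym negb_or a0.
    exists l0 => c cs l' ll' v' Xv' Cv'.
    have [Nv'|Nv'] := pselect (N l' v').
      by apply: (sP c) => // b sb; apply: cs; rewrite inE sb orbT.
    have [Mv' _] := Xv'.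
    have /submxP[D cX] := kX _ _ c Mv' Nv' Xv' (CN _ _ Cv').
    by have := cs a (mem_head _ _); rewrite cX -mulmxA aX mulmx0 eqxx.
  have Xc c : (c <= X)%MS.
    rewrite submxE; apply/eqP/row_matrixP => i; apply/rowP => j.
    rewrite (_ : cokermx X = 0) ?mulmx0 //.
    apply/matrixP => i' j'; have : col j' (cokermx X) = 0.
      apply: contrapT => /eqP cj; apply: Xfull; exists (col j' (cokermx X)) => //.
      by rewrite colE mulmxA mulmx_coker mul0mx.
    by move=> /colP/(_ i'); rewrite !mxE.
  have [l2 l2P] :=
    graded_noetherian gm acc fg (graded_sub_base gm) sX (sub_base sX).
  exists s => //; exists (maxn l0 l2.+1) => c cs l'.
  rewrite geq_max => /andP[l0l l2l] v' Xv'; apply: sP => //.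
  case: l' l2l {l0l} Xv' => // l'; rewrite ltnS => /l2P Xl' /Xl'.
  apply: sum_images_sub => //; first exact: (sub_base sN).
  move=> j u _ [Mu Xu]; have sk := killing_forms_subspace sN Mu.
  exact: (subspace_submx sk Xu (Xc _)).
by exists l, v.
Qed.

(** There is nothing to prove for C itself.  If no enlargement ever reached M, the
    previous lemma would give an infinite strictly ascending chain above C. *)
Lemma generic_injective C : graded_sub M B z C -> generically_injective C M.
Proof.
move=> sC.
pose good N := [/\ graded_sub M B z N, forall l, C l `<=` N l &
  generically_injective C N].
have goodC : good C.
  by split=> [//|l|]; [apply: subset_refl | exists [::] => //; exists 0%N].
have [[N [gN MN]]|] := pselect (exists N, good N /\ forall l, M l `<=` N l).
  have [sN _ [s s0 [l0 sP]]] := gN; exists s => //; exists l0 => c cs l ll v Mv.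
  by apply: sP => //; apply: MN.
move=> /forallNP bad.
have next (N : {N | good N}) : exists N' : {N | good N},
    (forall l, sval N l `<=` sval N' l) /\
    exists l v, sval N' l v /\ ~ sval N l v.
  case: N => N gN /=; have [sN CN iN] := gN.
  have [|N' [sN' NN' iN' lN']] := generically_injective_extend sC sN CN iN.
    apply: contrapT => nMN; apply: (bad N); split=> // l v Mv.
    by apply: contrapT => Nv; apply: nMN; exists l, v.
  have gN' : good N' by split=> // l; apply: subset_trans (CN l) (NN' l).
  by exists (exist _ N' gN').
have [f fP] := choice next.
pose S i := iter i f (exist _ C goodC).
have [||||i0 Si0] :=
  noetherian_chain acc (k := n) (C := C) (S := fun i => sval (S i)) (z := z).
- exact (graded_noetherian gm acc fg sC).
- by move=> i; have [] := svalP (S i).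
- by move=> i; have [] := svalP (S i).
- by move=> i; have [] := fP (S i).
have [_ [l [v [Sv nSv]]]] := fP (S i0); case: nSv.
exact: (Si0 i0.+1).
Qed.

(** The form g_k is general for the quotient of M by the preceding ones and, to
    keep the sequence linearly independent, avoids one more hyperplane, which
    contains their span. *)
Lemma exists_filter_regular : exists g : 'I_n -> 'rV[K]_n,
  row_free (\matrix_i g i) /\
  exists l0, forall l, (l0 <= l)%N -> forall i : 'I_n, forall v, M l v ->
    add_images M z (fun j : 'I_n => (j < i)%N) g B l.+1 (z (g i) v) ->
    add_images M z (fun j : 'I_n => (j < i)%N) g B l v.
Proof.
pose A g (k : nat) := add_images M z (fun j : 'I_n => (j < k)%N) g B.
have [g [rg gP]] : exists g : 'I_n -> 'rV[K]_n,
  \rank (\sum_(j < n | (j < n)%N) <<g j>>)%MS = n /\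
  exists l0, forall l, (l0 <= l)%N -> forall i : 'I_n, (i < n)%N -> forall v,
    M l v -> A g i l.+1 (z (g i) v) -> A g i l v; last first.
  exists g; split; last first.
    by have [l0 l0P] := gP; exists l0 => l ll i; apply: l0P.
  rewrite /row_free -[X in _ == X]rg; apply/eqP; apply/eqmx_rank.
  apply/andP; split; last first.
    apply/sumsmx_subP => j _; rewrite genmxE.
    by rewrite -(rowK g); apply: row_sub.
  apply/row_subP => i; rewrite rowK (sumsmx_sup i) ?ltn_ord //.
  by rewrite genmxE.
suff: forall k, (k <= n)%N -> exists g : 'I_n -> 'rV[K]_n,
  \rank (\sum_(j < n | (j < k)%N) <<g j>>)%MS = k /\
  exists l0, forall l, (l0 <= l)%N -> forall i : 'I_n, (i < k)%N -> forall v,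
    M l v -> A g i l.+1 (z (g i) v) -> A g i l v by exact.
elim=> [_|k IH lt_kn].
  exists (fun=> 0); split; last by exists 0%N.
  by rewrite big_pred0 // mxrank0.
have [g [rg [l0 gP]]] := IH (ltnW lt_kn).
set W := (\sum_(j < n | (j < k)%N) <<g j>>)%MS in rg.
have sA : graded_sub M B z (A g k).
  exact: (graded_sub_add_images gm _ _ (graded_sub_base gm)).
have [s s0 [l1 sP]] := generic_injective sA.
have [j0 aj0] : exists j, col j (cokermx W) != 0.
  apply: contrapT => /forallNP W0; have : \rank (cokermx W) = 0%N.
    apply/eqP; rewrite mxrank_eq0; apply/eqP/matrixP => i j.
    by have /negP/negPn/eqP/colP/(_ i) := W0 j; rewrite !mxE.
  by rewrite mxrank_coker rg => /eqP; rewrite subn_eq0 leqNgt lt_kn.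
have [|c cP] := @avoid_hyperplanes K n (col j0 (cokermx W) :: s).
  by rewrite inE eq_sym negb_or aj0.
pose ki := Ordinal lt_kn; pose g' j := if j == ki then c else g j.
have g'E (j : 'I_n) : (j < k)%N -> g' j = g j.
  by move=> jk; rewrite /g' -val_eqE /= ltn_eqF.
have AE i : (i <= k)%N -> A g' i = A g i.
  move=> ik; apply/funext => -[//|l]; apply/seteqP.
  have E p : \sum_(j < n | (j < i)%N) z (g' j) (p j) =
             \sum_(j < n | (j < i)%N) z (g j) (p j).
    by apply: eq_bigr => j ji; rewrite g'E // (leq_trans ji).
  by split=> v [p Mp Bp]; exists p => //; rewrite E in Bp *.
exists g'; split; last first.
  exists (maxn l0 l1) => l; rewrite geq_max => /andP[ll0 ll1] i.
  rewrite ltnS leq_eqVlt => /orP[/eqP ik|ik] v Mv; last first.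
    by rewrite (AE _ (ltnW ik)) (g'E _ ik); apply: gP.
  have -> : i = ki by apply: val_inj.
  rewrite AE // {1}/g' eqxx; apply: sP => // a sa.
  by apply: cP; rewrite inE sa orbT.
rewrite (bigD1 ki) //= {1}/g' eqxx.
rewrite (eq_bigl (fun j : 'I_n => (j < k)%N)); last first.
  move=> j /=; rewrite ltnS (leq_eqVlt j) -val_eqE /=.
  by case: (ltngtP j k).
rewrite (eq_bigr (fun j => <<g j>>%MS)); last by move=> j /g'E ->.
rewrite -/W addsmxC.
have cW : ~~ (c <= W)%MS.
  apply/negP => /submxP[D cD]; have := cP _ (mem_head _ _).
  by rewrite cD -mulmxA colE [W *m _]mulmxA mulmx_coker mul0mx mulmx0 eqxx.
apply/eqP; rewrite eqn_leq; apply/andP; split.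
  apply: leq_trans (mxrank_adds_leqif _ _).1 _.
  by rewrite rg mxrank_gen -[k.+1]addn1 leq_add2l rank_leq_row.
rewrite -{1}rg ltnNge; apply: contra cW => le.
apply: rank_adds_submx; apply: leq_trans le.
by apply: mxrankS; rewrite addsmxS // genmxE.
Qed.

End FilterRegular.

(** * Reduction modulo the maximal ideal, and lifting *)

Section Reduction.
Variables (K : fieldType) (F : comNzRingType) (ev : {rmorphism F -> K}).
Variables (V : lmodType F).
Implicit Types N B : set V.

(** The submodule N' + m N, where m is the kernel of ev: N modulo it is the fibre
    of N / N' at the closed point. *)
Definition reduced N N' : set V :=
  generated (N' `|` [set v | exists a u, [/\ ev a = 0, N u & v = a *: u]]).

Lemma generated_submodule (S : set V) : submodule (generated S).
Proof.
apply/submoduleP; split=> [N [sN _]|a u v gu gv N [sN SN]].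
  exact: submodule0.
by apply: submoduleZD => //; [apply: gu | apply: gv].
Qed.

Section Reduced.
Variables (N N' : set V) (sN : submodule N) (sN' : submodule N').

Lemma reduced_submodule : submodule (reduced N N').
Proof. exact: generated_submodule. Qed.

Lemma sub_reduced : N' `<=` reduced N N'.
Proof. by move=> v Nv; apply: sub_gen_smallest; left. Qed.

Lemma reducedZ a v : ev a = 0 -> N v -> reduced N N' (a *: v).
Proof. by move=> a0 Nv; apply: sub_gen_smallest; right; exists a, v. Qed.

Lemma reduced_sub T : submodule T -> N' `<=` T ->
  (forall a v, ev a = 0 -> N v -> T (a *: v)) -> reduced N N' `<=` T.
Proof.
move=> sT NT mT; apply: smallest_sub => // v [/NT//|[a [u [a0 Nu ->]]]].
exact: mT.
Qed.

Lemma reduced_top : N' `<=` N -> reduced N N' `<=` N.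
Proof. by move=> NN; apply: reduced_sub => // a v _; apply: submoduleZ. Qed.

Lemma reduced_basis r (e : 'I_r -> V) v : quotient_basis N N' e ->
  reduced N N' v <->
  exists2 a : 'I_r -> F, forall i, ev (a i) = 0 & N' (v - \sum_i a i *: e i).
Proof.
move=> [Ne span_e free_e]; split; last first.
  move=> [a a0 Nv]; apply: (submodule_mod reduced_submodule (sub_reduced Nv)).
  by apply: submodule_sum => [|i _]; [exact: reduced_submodule | exact: reducedZ].
move: v; apply: (reduced_sub (T := [set v | exists2 a : 'I_r -> F,
  forall i, ev (a i) = 0 & N' (v - \sum_i a i *: e i)])) => [|v Nv|a v a0 Nv].
- apply/submoduleP; split.
    exists (fun=> 0) => [i|]; first by rewrite rmorph0.
    by rewrite big1 ?subrr => [|i _]; [exact: submodule0 | rewrite scale0r].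
  move=> c u v [a a0 Na] [b b0 Nb]; exists (fun i => c * a i + b i) => [i|].
    by rewrite rmorphD rmorphM a0 b0 mulr0 addr0.
  rewrite (eq_bigr (fun i => c *: (a i *: e i) + b i *: e i)) => [|i _]; last first.
    by rewrite scalerDl scalerA.
  rewrite big_split /= -scaler_sumr opprD addrACA -scalerBr.
  exact: submoduleZD.
- exists (fun=> 0) => [i|]; first by rewrite rmorph0.
  by rewrite big1 ?subr0 => // i _; rewrite scale0r.
- have [b Nb] := span_e v Nv; exists (fun i => a * b i) => [i|].
    by rewrite rmorphM a0 mul0r.
  rewrite (eq_bigr (fun i => a *: (b i *: e i))) => [|i _]; last first.
    by rewrite scalerA.
  by rewrite -scaler_sumr -scalerBr; apply: submoduleZ.
Qed.

End Reduced.
End Reduction.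

Section LocalRing.
Variables (K : fieldType) (F : comNzRingType).
Variables (cst : {rmorphism K -> F}) (ev : {rmorphism F -> K}).
Hypothesis evK : cancel cst ev.
Hypothesis unitF : forall a, ev a != 0 -> exists b, b * a = 1.

(** The determinant is not in the maximal ideal, so it is a unit; the adjugate
    does the rest. *)
Lemma local_invertible s (D : 'M[F]_s) : map_mx ev D = 1%:M ->
  exists2 E, E *m D = 1%:M & D *m E = 1%:M.
Proof.
move=> D1; have [|b bD] := @unitF (\det D).
  by rewrite -det_map_mx D1 det1 oner_neq0.
exists (b *: \adj D).
  by rewrite -scalemxAl mul_adj_mx scale_scalar_mx bD.
by rewrite -scalemxAr mul_mx_adj scale_scalar_mx bD.
Qed.

(** Constant rows that complete the reduction of A to a basis also complete A.
    Stating this with a two-sided inverse G avoids a cast along r + t = s. *)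
Lemma local_row_free r s (A : 'M[F]_(r, s)) : row_free (map_mx ev A) ->
  exists t (C : 'M[F]_(t, s)) (G : 'M[F]_(s, r + t)),
    col_mx A C *m G = 1%:M /\ G *m col_mx A C = 1%:M.
Proof.
move=> freeA; set A' := map_mx ev A in freeA.
pose C' := row_base (A'^C)%MS.
pose D := col_mx A' C'.
have fullD : row_full D.
  rewrite -sub1mx (submx_trans (submx_full _ (addsmx_compl_full A'))) //.
  rewrite -addsmxE addsmxS // /C' eq_row_base //.
have freeD : row_free D.
  apply/eqP; rewrite [LHS](eqP fullD) mxrank_compl [in RHS](eqP freeA).
  by rewrite subnKC // -(eqP freeA) rank_leq_col.
have [G1 GD] := row_fullP fullD.
have [G2 DG] := row_freeP freeD.
have G12 : G1 = G2 by rewrite -[G1]mulmx1 -DG mulmxA GD mul1mx.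
rewrite -{}G12 in DG.
pose C := map_mx cst C'; pose G0 := map_mx cst G1; pose D0 := col_mx A C.
have evcst m n (X : 'M[K]_(m, n)) : map_mx ev (map_mx cst X) = X.
  by apply/matrixP => i j; rewrite !mxE evK.
have evD : map_mx ev D0 = D by rewrite map_col_mx evcst.
have [|E1 _ E1P] := @local_invertible _ (D0 *m G0).
  by rewrite map_mxM evD evcst.
have [|E2 E2P _] := @local_invertible _ (G0 *m D0).
  by rewrite map_mxM evD evcst.
exists _, C, (G0 *m E1); rewrite -/D0; split; first by rewrite mulmxA.
suff -> : G0 *m E1 = E2 *m G0 by rewrite -mulmxA.
by rewrite -[RHS]mulmx1 -E1P !mulmxA -[E2 *m G0 *m D0]mulmxA E2P mul1mx.
Qed.

Variable V : lmodType F.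

Definition comb s (f : 'I_s -> V) (b : 'rV[F]_s) : V := \sum_j b 0 j *: f j.

Lemma combD s (f : 'I_s -> V) b c : comb f (b + c) = comb f b + comb f c.
Proof.
by rewrite -big_split; apply: eq_bigr => j _; rewrite mxE scalerDl.
Qed.

Lemma combN s (f : 'I_s -> V) b : comb f (- b) = - comb f b.
Proof. by rewrite -sumrN; apply: eq_bigr => j _; rewrite mxE scaleNr. Qed.

Lemma combZ s (f : 'I_s -> V) a b : comb f (a *: b) = a *: comb f b.
Proof.
by rewrite scaler_sumr; apply: eq_bigr => j _; rewrite mxE scalerA.
Qed.

Lemma comb_delta s (f : 'I_s -> V) j : comb f (delta_mx 0 j) = f j.
Proof.
rewrite /comb (bigD1 j) //= mxE !eqxx scale1r big1 ?addr0 // => i /negPf ij.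
by rewrite mxE ij andbF scale0r.
Qed.

Lemma comb_mul r s (f : 'I_s -> V) (a : 'rV[F]_r) (A : 'M[F]_(r, s)) :
  comb f (a *m A) = comb (fun i => comb f (row i A)) a.
Proof.
rewrite /comb (eq_bigr (fun j => \sum_i a 0 i *: (A i j *: f j))) => [|j _].
  rewrite exchange_big; apply: eq_bigr => i _.
  by rewrite scaler_sumr; apply: eq_bigr => j _; rewrite mxE.
by rewrite mxE scaler_suml; apply: eq_bigr => i _; rewrite scalerA.
Qed.

Lemma quotient_basis_comb (N N' : set V) r (e : 'I_r -> V) :
  submodule N -> quotient_basis N N' e ->
  [/\ forall a, N (comb e a), forall v, N v -> exists a, N' (v - comb e a) &
      forall a, N' (comb e a) -> a = 0].
Proof.
move=> sN [Ne span_e free_e]; split=> [a|v /span_e[a Na]|a Na].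
- by apply: submodule_sum => // i _; apply: submoduleZ.
- exists (\row_i a i); rewrite /comb.
  by under eq_bigr => i _ do rewrite mxE.
- by apply/rowP => i; rewrite mxE; apply: (free_e (fun i => a 0 i)).
Qed.

Lemma basis_comb (N N' : set V) r (e : 'I_r -> V) :
  (forall i, N (e i)) -> (forall v, N v -> exists a, N' (v - comb e a)) ->
  (forall a, N' (comb e a) -> a = 0) -> quotient_basis N N' e.
Proof.
move=> Ne span_e free_e; split=> // [v /span_e[a Na]|a Na i].
  by exists (fun i => a 0 i).
have /rowP/(_ i) : \row_i a i = 0; last by rewrite !mxE.
apply: free_e; congr N': Na; apply: eq_bigr => j _.
by rewrite mxE.
Qed.

(** In this section phi induces a linear map from the free module N / N1 to the
    free module N' / N2 that is injective at the closed point. *)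
Section SplitInjection.
Variables (N N1 N' N2 : set V) (phi : V -> V).
Hypotheses (sN : submodule N) (sN1 : submodule N1).
Hypotheses (sN' : submodule N') (sN2 : submodule N2).
Hypothesis phiD : forall u v, phi (u + v) = phi u + phi v.
Hypothesis phiZ : forall a v, N v -> N2 (phi (a *: v) - a *: phi v).
Hypotheses (phiN : forall v, N v -> N' (phi v)).
Hypotheses (phiN1 : forall v, N1 v -> N2 (phi v)).
Hypothesis phi_inj :
  forall v, N v -> reduced ev N' N2 (phi v) -> reduced ev N N1 v.
Variables (r s : nat) (e : 'I_r -> V) (f : 'I_s -> V).
Hypotheses (eP : quotient_basis N N1 e) (fP : quotient_basis N' N2 f).

(** The matrix A of the induced map has independent rows at the closed point: a
    constant relation between them is sent by phi into N2 + m N', hence comes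
    from an element of N1 + m N. *)
Lemma phi_comb : exists2 A : 'M[F]_(r, s), row_free (map_mx ev A) &
  forall v a, N1 (v - comb e a) -> N2 (phi v - comb f (a *m A)).
Proof.
have [Ne span_e free_e] := quotient_basis_comb sN eP.
have [Nf span_f free_f] := quotient_basis_comb sN' fP.
have [Ne' _ _] := eP.
have [A0 A0P] := choice (fun i => span_f _ (phiN (Ne' i))).
pose A := \matrix_i A0 i.
have phi0 : phi 0 = 0 by apply: (addrI (phi 0)); rewrite -phiD !addr0.
have phiB u v : phi (u - v) = phi u - phi v.
  by apply: (addIr (phi v)); rewrite -phiD !subrK.
have phi_sum (a : 'rV_r) : N2 (phi (comb e a) - comb f (a *m A)).
  rewrite comb_mul (big_morph phi phiD phi0) -sumrB.
  apply: submodule_sum => // i _.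
  apply: (submodule_mod sN2 (v := a 0 i *: phi (e i) - a 0 i *: comb f (row i A))).
    by rewrite opprB addrA subrK; apply: phiZ.
  by rewrite -scalerBr rowK; apply: submoduleZ.
have phiA v a : N1 (v - comb e a) -> N2 (phi v - comb f (a *m A)).
  move=> /phiN1; rewrite phiB => Nva.
  have := submoduleD sN2 Nva (phi_sum a).
  by rewrite addrA subrK.
exists A => //; apply: inj_row_free => c cA.
pose a := map_mx cst c; have eva i : ev (a 0 i) = c 0 i by rewrite mxE evK.
have : reduced ev N' N2 (phi (comb e a)).
  apply/(reduced_basis ev sN2 _ fP).
  exists (fun j => (a *m A) 0 j); last exact: phi_sum.
  move=> j; have /rowP/(_ j) := cA; rewrite !mxE rmorph_sum => cAj.
  rewrite -[RHS]cAj; apply: eq_bigr => i _.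
  by rewrite rmorphM eva [in RHS]mxE.
move=> /(phi_inj (Ne a))/(reduced_basis ev sN1 _ eP)[b b0 Nab].
have /rowP ab : a - \row_i b i = 0.
  apply: free_e; rewrite combD combN; congr N1: Nab.
  by congr (_ - _); apply: eq_bigr => i _; rewrite mxE.
apply/rowP => i; have := ab i; rewrite !mxE => /eqP; rewrite subr_eq0 => /eqP abi.
by rewrite -eva mxE abi.
Qed.

(** A can be completed to an invertible matrix, so its rows are independent over
    the local ring. *)
Lemma lift_injective v : N v -> N2 (phi v) -> N1 v.
Proof.
have [Ne span_e free_e] := quotient_basis_comb sN eP.
have [Nf span_f free_f] := quotient_basis_comb sN' fP.
have [A freeA phiA] := phi_comb.
have [t [C [G [DG _]]]] := local_row_free freeA.
move=> /span_e[a Na] Nphi; have := phiA _ _ Na => Nphi'.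
have aA : a *m A = 0.
  by apply: free_f; apply: submodule_modC Nphi' Nphi.
suff a0 : a = 0.
  move: Na; rewrite a0 /comb big1 ?subr0 // => i _.
  by rewrite mxE scale0r.
have : row_mx a (0 : 'rV_t) = 0.
  by rewrite -[LHS]mulmx1 -DG mulmxA mul_row_col aA mul0mx addr0 mul0mx.
by rewrite -[X in _ = X]row_mx0 => /eq_row_mx[].
Qed.

(** The rows that complete A to an invertible matrix give a basis. *)
Lemma cokernel_free : exists t,
  quotient_rank N' [set w | exists2 v, N v & N2 (w - phi v)] t.
Proof.
have [Ne span_e free_e] := quotient_basis_comb sN eP.
have [Nf span_f free_f] := quotient_basis_comb sN' fP.
have [A freeA phiA] := phi_comb.
have [t [C [G [DG GD]]]] := local_row_free freeA.
exists t, (fun k => comb f (row k C)); split=> [k|w /span_f[b Nb]|y [v Nv Nyv]].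
- exact: Nf.
- pose xy := b *m G.
  have bE : b = lsubmx xy *m A + rsubmx xy *m C.
    by rewrite -mul_row_col hsubmxK -mulmxA GD mulmx1.
  exists (fun k => rsubmx xy 0 k), (comb e (lsubmx xy)) => //.
  have /phiA Nx : N1 (comb e (lsubmx xy) - comb e (lsubmx xy)).
    by rewrite subrr; apply: submodule0.
  set X := comb f (_ *m A) in Nx *; set p := phi _ in Nx *.
  have bE' : comb f b = comb (fun k => comb f (row k C)) (rsubmx xy) + X.
    by rewrite [in LHS]bE combD addrC comb_mul.
  have := submoduleB sN2 Nb Nx.
  by rewrite bE' opprD opprB !addrA subrK.
- have [a Na] := span_e v Nv.
  have Nay := submoduleD sN2 Nyv (phiA _ _ Na).
  pose y' := \row_k y k.
  have y'a : y' *m C - a *m A = 0.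
    apply: free_f; rewrite combD combN comb_mul; congr N2: Nay.
    rewrite addrA subrK; congr (_ - _).
    by apply: eq_bigr => k _; rewrite mxE.
  have ay0 : row_mx (- a) y' = 0.
    rewrite -[LHS]mulmx1 -DG mulmxA mul_row_col mulNmx addrC y'a mul0mx //.
  move=> k; have := congr1 (fun x => rsubmx x 0 k) ay0.
  by rewrite row_mxKr /y' !mxE.
Qed.

End SplitInjection.

End LocalRing.

(** * Filter-regular sequences over a local ring *)

Section FreeGraded.
Variables (K : numFieldType) (F : comNzRingType).
Variables (cst : {rmorphism K -> F}) (ev : {rmorphism F -> K}).
Hypothesis evK : cancel cst ev.
Hypothesis unitF : forall a, ev a != 0 -> exists b, b * a = 1.
Variables (V : lmodType F) (n : nat).
Variables (M B : nat -> set V) (z : 'rV[K]_n -> V -> V).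
Hypothesis gm : graded_module cst M B z.
Hypothesis fg : graded_fg M B z.
Hypothesis freeM : forall l, exists r, quotient_rank (M l) (B l) r.

Let subM := graded_M gm.
Let subB := graded_B gm.

Definition fibre l := reduced ev (M l) (B l).

Lemma graded_module_fibre : graded_module cst M fibre z.
Proof.
have Bf l : B l `<=` fibre l by apply: sub_reduced.
have sf l : submodule (fibre l) by apply: reduced_submodule.
split=> //.
- by move=> l; apply: reduced_top => //; apply: (graded_BM gm).
- exact: graded_zM gm.
- move=> l c; suff : fibre l `<=` [set v | M l v /\ fibre l.+1 (z c v)].
    by move=> fl v /fl[].
  apply: reduced_sub => [|v Bv|a v a0 Mv].
  + apply/submoduleP; split=> [|a u v [Mu fu] [Mv fv]].
      by rewrite /= (act0 gm); split; apply: submodule0.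
    split; first exact: submoduleZD.
    rewrite (graded_zD gm); apply: (submoduleD (sf _)) => //.
    apply: (submodule_mod (sf _) _ (submoduleZ (sf _) a fu)).
    by apply: Bf; apply: (graded_zZ gm).
  + by split; [apply: (graded_BM gm) | apply: Bf; apply: (graded_zB gm)].
  + split; first exact: submoduleZ.
    apply: (submodule_mod (sf _) (v := a *: z c v)).
      by apply: Bf; apply: (graded_zZ gm).
    by apply: reducedZ => //; apply: (graded_zM gm).
- exact: graded_zD gm.
- by move=> l c a v Mv; apply: Bf; apply: (graded_zZ gm).
- by move=> l c d v Mv; apply: Bf; apply: (graded_zC gm).
- by move=> l k c d v Mv; apply: Bf; apply: (graded_zL gm).
Qed.

Lemma graded_fg_fibre : graded_fg M fibre z.
Proof.
have [l0 l0P] := fg; exists l0 => l /l0P lM v /lM[p Mp Bp].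
by exists p => //; apply: sub_reduced.
Qed.

(** Between B l + m M l and M l, a submodule is determined by the constant
    combinations of a basis that it contains, which form a subspace of K^r. *)
Lemma graded_acc_fibre : graded_acc M fibre.
Proof.
move=> l N sN fN NM Nup; have [r [e eP]] := freeM l.
have [Ne span_e _] := eP.
pose lift (c : 'rV[K]_r) := \sum_i cst (c 0 i) *: e i.
pose S i : set 'rV[K]_r := [set c | N i (lift c)].
have [||i0 Si0] := @subspace_chain K r S.
- move=> i; apply/submoduleP; split.
    rewrite /S /= /lift big1 => [|j _]; first exact: submodule0.
    by rewrite mxE rmorph0 scale0r.
  move=> a u v Su Sv; have -> : S i (a *: u + v) = N i (cst a *: lift u + lift v).
    congr (N i _); rewrite scaler_sumr -big_split; apply: eq_bigr => j _.
    by rewrite !mxE rmorphD rmorphM scalerDl scalerA.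
  exact: submoduleZD.
- by move=> i c; apply: Nup.
exists i0 => i v Nv; have [a Ba] := span_e v (NM _ _ Nv).
pose c := \row_j ev (a j).
have fv : fibre l (v - lift c).
  have -> : v - lift c = (v - \sum_j a j *: e j) +
      \sum_j (a j - cst (ev (a j))) *: e j.
    suff -> : \sum_j (a j - cst (ev (a j))) *: e j = \sum_j a j *: e j - lift c.
      by rewrite addrA subrK.
    rewrite -sumrB; by apply: eq_bigr => j _; rewrite mxE scalerBl.
  apply: (submoduleD (reduced_submodule _ _ _)); first exact: sub_reduced.
  apply: submodule_sum => [|j _]; first exact: reduced_submodule.
  by apply: reducedZ => //; rewrite rmorphB evK subrr.
apply: (submodule_mod (sN i0) (fN i0 _ fv)); apply: (Si0 i).
by apply: (submodule_modC (sN i) _ Nv); apply: fN fv.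
Qed.

Lemma add_images_fibre (I : finType) (Q : pred I) (g : I -> 'rV[K]_n) l :
  add_images M z Q g fibre l = reduced ev (M l) (add_images M z Q g B l).
Proof.
case: l => [//|l]; rewrite /add_images.
have BM := graded_BM gm.
have sR : submodule (reduced ev (M l.+1)
    (sum_images Q (fun i => z (g i)) (M l) (B l.+1))) by exact: reduced_submodule.
have Bs : B l.+1 `<=` sum_images Q (fun i => z (g i)) (M l) (B l.+1).
  by apply: (images_base gm Q g (N := M)).
have gf := graded_module_fibre.
have fs : fibre l.+1 `<=` sum_images Q (fun i => z (g i)) (M l) (fibre l.+1).
  by apply: (images_base gf Q g (N := M)) => //; apply: graded_B gf _.
apply/seteqP; split.
  apply: sum_images_sub => //.
    apply: reduced_sub => // [v /Bs/sub_reduced //|a v a0 Mv].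
    exact: reducedZ.
  move=> i v Qi Mv; apply: sub_reduced.
  exact: (images_image gm g (N := M)).
apply: reduced_sub.
- apply: (images_submodule gf Q g (N := M)) => //; exact: graded_B gf _.
- move=> v [p Mp Bp]; exists p => //; exact: sub_reduced.
- by move=> a v a0 Mv; apply: fs; apply: reducedZ.
Qed.

(** The sequence found on the fibre works.  The freeness of the successive
    quotients in high degrees, which is part of the induction, is what makes the
    injectivity at the closed point lift. *)
Lemma exists_ordinary_basis : exists g : 'I_n -> 'rV[K]_n,
  row_free (\matrix_i g i) /\
  exists l0, forall l, (l0 <= l)%N -> forall i : 'I_n, forall v, M l v ->
    add_images M z (fun j : 'I_n => (j < i)%N) g B l.+1 (z (g i) v) ->
    add_images M z (fun j : 'I_n => (j < i)%N) g B l v.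
Proof.
have [g [freeg [l0 gP]]] := exists_filter_regular graded_module_fibre
  graded_acc_fibre graded_fg_fibre.
exists g; split=> //.
pose A i := add_images M z (fun j : 'I_n => (j < i)%N) g B.
have gA i : graded_sub M B z (A i).
  exact: (graded_sub_add_images gm _ _ (graded_sub_base gm)).
have sA i l : submodule (A i l) by apply: (sub_submodule (gA i)).
have split_step l (i : 'I_n) r s (e : 'I_r -> V) (f : 'I_s -> V) : (l0 <= l)%N ->
    quotient_basis (M l) (A i l) e -> quotient_basis (M l.+1) (A i l.+1) f ->
    (forall v, M l v -> A i l.+1 (z (g i) v) -> A i l v) /\
    exists t, quotient_rank (M l.+1) (A i.+1 l.+1) t.
  move=> ll eP fP.
  have zA a v : M l v -> A i l.+1 (z (g i) (a *: v) - a *: z (g i) v).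
    by move=> Mv; apply: (sub_base (gA i)); apply: (graded_zZ gm).
  have inj v : M l v -> reduced ev (M l.+1) (A i l.+1) (z (g i) v) ->
      reduced ev (M l) (A i l) v.
    by rewrite -!add_images_fibre; apply: gP.
  split.
    move=> v Mv.
    apply: (lift_injective evK unitF (subM l) (sA i l) (subM l.+1) (sA i l.+1)
      (graded_zD gm (g i)) zA _ _ inj eP fP Mv).
      apply: (graded_zM gm).
    apply: (sub_stable (gA i)).
  have [||t tP] := cokernel_free evK unitF (subM l) (sA i l) (subM l.+1) (sA i l.+1)
      (graded_zD gm (g i)) zA _ _ inj eP fP.
  - apply: (graded_zM gm).
  - apply: (sub_stable (gA i)).
  exists t; congr (quotient_rank _ _ t): tP; apply/seteqP; split=> w.
    move=> [v Mv Aw]; apply: (submodule_mod (sA _ _) (v := z (g i) v)).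
      move: Aw; apply: sum_images_sub => //.
        exact: (images_base gm _ g (N := M)).
      move=> j u ji Mu; apply: (images_image gm g (N := M)) => //=.
      exact: leqW.
    exact: (images_image gm g (N := M)).
  move=> [p Mp Bp]; exists (p i) => //; exists p => //.
  move: Bp; rewrite (bigD1 i) //= opprD addrA.
  congr (B _ (_ - _)); apply: eq_bigl => j.
  by rewrite ltnS (leq_eqVlt j) -val_eqE /=; case: (ltngtP j i).
have free_A : forall i, (i <= n)%N -> exists l1, forall l, (l1 <= l)%N ->
    exists r, quotient_rank (M l) (A i l) r.
  elim=> [_|i IH lt_in].
    exists 0%N => l _; have [r rP] := freeM l; exists r.
    suff -> : A 0%N l = B l by [].
    case: l {rP} => [//|l]; apply/seteqP; split=> v.
      by move=> [p _]; rewrite big_pred0 // subr0.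
    by apply: (images_base gm _ g (N := M)).
  have [l1 l1P] := IH (ltnW lt_in); exists (maxn l0 l1).+1 => -[//|l].
  rewrite ltnS geq_max => /andP[l0l l1l].
  have [r [e eP]] := l1P l l1l.
  have [s [f fP]] := l1P l.+1 (leqW l1l).
  by have [_] := split_step l (Ordinal lt_in) r s e f l0l eP fP.
have [l1 l1P] : exists l1, forall i : 'I_n, forall l, (l1 <= l)%N ->
    exists r, quotient_rank (M l) (A i l) r.
  have [f fP] := choice (fun i : 'I_n => free_A i (ltnW (ltn_ord i))).
  exists (\max_i f i) => i l fl; apply: fP; apply: leq_trans fl.
  exact: leq_bigmax.
exists (maxn l0 l1) => l; rewrite geq_max => /andP[l0l l1l] i.
have [r [e eP]] := l1P i l l1l.
have [s [f fP]] := l1P i l.+1 (leqW l1l).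
by have [] := split_step l i r s e f l0l eP fP.
Qed.

End FreeGraded.

(** * Symmetry of second derivatives *)

Section Schwarz.
Variable R : realType.
Implicit Types (f : Rinfty R -> R) (U A : set (Rinfty R)) (x : Rinfty R).

Lemma move_at i x t : move i x t i = t.
Proof. by rewrite /move dfwithin. Qed.

Lemma move_other i j x t : i != j -> move i x t j = x j.
Proof. by move=> ij; rewrite /move dfwithout. Qed.

Lemma move_move i x s t : move i (move i x s) t = move i x t.
Proof.
apply/funext => k; have [->|ik] := eqVneq i k; first by rewrite !move_at.
by rewrite !move_other.
Qed.

Lemma move_comm i j x s t : i != j ->
  move i (move j x t) s = move j (move i x s) t.
Proof.
move=> ij; apply/funext => k.
have [<-|ik] := eqVneq i k.
  by rewrite move_at move_other 1?eq_sym // move_at.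
rewrite move_other //; have [<-|jk] := eqVneq j k; first by rewrite !move_at.
by rewrite !move_other.
Qed.

(** The product topology makes the insertion of two coordinates jointly
    continuous. *)
Lemma nbhs_box i j x A : i != j -> nbhs x A -> exists2 e : R, 0 < e &
  forall s t, `|s - x i| < e -> `|t - x j| < e -> A (move i (move j x t) s).
Proof.
move=> ij nA.
pose m (st : R * R) : Rinfty R := move i (move j x st.2) st.1.
have mx : m (x i, x j) = x by rewrite /m /= !move_id.
have cm : m @ nbhs (x i, x j) --> x.
  apply/pointwise_cvgP => k.
  have [->|ik] := eqVneq k i.
    rewrite (_ : _ @ _ = (fun st => m st i) @ nbhs (x i, x j)) //.
    rewrite (_ : (fun st => m st i) = fst); first exact: cvg_fst.
    by apply/funext => st; rewrite /m move_at.
  rewrite (_ : _ @ _ = (fun st => m st k) @ nbhs (x i, x j)) //.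
  have [->|jk] := eqVneq k j.
    rewrite (_ : (fun st => m st j) = snd); first exact: cvg_snd.
    by apply/funext => st; rewrite /m move_other // move_at.
  rewrite (_ : (fun st => m st k) = fun=> x k); first exact: cvg_cst.
  by apply/funext => st; rewrite /m !move_other 1?eq_sym.
have /nbhs_ballP[e /= e0 eA] : nbhs (x i, x j) (m @^-1` A) by apply: cm.
exists e => // s t se te.
by apply: (eA (s, t)); split; rewrite /ball /= distrC.
Qed.

(** The mean value theorem is applied to the difference in the direction j, as a
    function of the coordinate i, and then to partial i f in the direction j. *)
Lemma mixed_difference i j f U x (h : R) : i != j -> open U -> class_C 2 U f ->
  0 < h ->
  (forall s t, x i <= s <= x i + h -> x j <= t <= x j + h ->
     U (move i (move j x t) s)) ->
  exists s t, [/\ x i < s < x i + h, x j < t < x j + h &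
    f (move i (move j x (x j + h)) (x i + h)) - f (move i x (x i + h)) -
    (f (move j x (x j + h)) - f x) =
    partial j (partial i f) (move i (move j x t) s) * h * h].
Proof.
move=> ij oU Cf h0 Ubox; set a := x i in Ubox *; set b := x j in Ubox *.
pose y s t := move i (move j x t) s.
have ij' : j != i by rewrite eq_sym.
have [_ /(_ i)[dfi Cfi]] := Cf; have [_ /(_ j)[dfij _]] := Cfi.
have aah : a < a + h by rewrite ltrDl.
have bbh : b < b + h by rewrite ltrDl.
have fy t s : line i f (y s t) = fun s' => f (y s' t).
  by apply/funext => s'; rewrite /line /y move_move.
have gy s t : line j (partial i f) (y s t) = fun t' => partial i f (y s t').
  apply/funext => t'; rewrite /line /y (move_comm _ _ _ ij) move_move.
  by rewrite [in RHS](move_comm _ _ _ ij).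
have dphi s t : a <= s <= a + h -> b <= t <= b + h ->
    is_derive s 1 (fun s => f (y s t)) (partial i f (y s t)).
  move=> sI tI; have := dfi _ (Ubox s t sI tI).
  have yi : y s t i = s by rewrite /y move_at.
  rewrite -/(y s t) fy yi => /derivableP.
  by rewrite /partial fy yi derive1E.
have dpsi s t : a <= s <= a + h -> b <= t <= b + h ->
    is_derive t 1 (fun t => partial i f (y s t)) (partial j (partial i f) (y s t)).
  move=> sI tI; have := dfij _ (Ubox s t sI tI).
  have yj : y s t j = t by rewrite /y move_other // move_at.
  rewrite -/(y s t) gy yj => /derivableP.
  rewrite -[partial j _ _]/(derive1 (line j (partial i f) (y s t)) (y s t j)).
  by rewrite gy yj derive1E.
have aI : b <= b <= b + h by rewrite lexx ltW.
have ahI : b <= b + h <= b + h by rewrite lexx ltW.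
pose phi s := f (y s (b + h)) - f (y s b).
have dphi' s : a <= s <= a + h ->
    is_derive s 1 phi (partial i f (y s (b + h)) - partial i f (y s b)).
  move=> sI; apply: is_deriveB; exact: dphi.
have [|| s sI Ds] := @MVT R phi
    (fun s => partial i f (y s (b + h)) - partial i f (y s b)) _ _ aah.
- by move=> s /subset_itv_oo_cc; rewrite in_itv /=; apply: dphi'.
- apply: derivable_within_continuous => s; rewrite in_itv /= => sI.
  by case: (dphi' s sI).
have sI' : a <= s <= a + h by move: sI => /subset_itv_oo_cc; rewrite in_itv.
have [|| t tI Dt] := @MVT R (fun t => partial i f (y s t))
    (fun t => partial j (partial i f) (y s t)) _ _ bbh.
- by move=> t /subset_itv_oo_cc; rewrite in_itv /=; apply: dpsi.
- apply: derivable_within_continuous => t; rewrite in_itv /= => tI.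
  by case: (dpsi s t sI' tI).
exists s, t; split; [by rewrite in_itv in sI | by rewrite in_itv in tI |].
have hE (u : R) : u + h - u = h by rewrite addrAC subrr add0r.
move: Ds; rewrite Dt !hE /phi => <-.
have yb s' : y s' b = move i x s' by rewrite /y move_id.
have ya t' : y a t' = move j x t' by rewrite /y (move_comm _ _ _ ij) move_id.
by rewrite !yb ya -/(y (a + h) (b + h)) move_id.
Qed.

(** The second difference is symmetric in i and j, so that a value of one mixed
    derivative near x equals a value of the other one near x. *)
Lemma schwarz i j f U x : open U -> U x -> class_C 2 U f ->
  partial i (partial j f) x = partial j (partial i f) x.
Proof.
move=> oU Ux Cf; have [->//|ij] := eqVneq i j.
have ji : j != i by rewrite eq_sym.
have [_ /(_ i)[_ [_ /(_ j)[_ [cji _]]]]] := Cf.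
have [_ /(_ j)[_ [_ /(_ i)[_ [cij _]]]]] := Cf.
apply/eqP; rewrite -subr_eq0; apply: contrapT => /negP d0.
set d := _ - _ in d0; have e0 : 0 < `|d| / 2 by rewrite divr_gt0 ?normr_gt0.
have nU : nbhs x U by apply: open_nbhs_nbhs; split.
have near_x (g : Rinfty R -> R) : {for x, continuous g} ->
    nbhs x [set y | `|g x - g y| < `|d| / 2].
  by move=> cg; move: cg => /cvgr_dist_lt/(_ _ e0).
have n1 := near_x _ (cji x Ux); have n2 := near_x _ (cij x Ux).
have [e e_gt0 eP] := nbhs_box ij (filterI nU (filterI n1 n2)).
pose h := e / 2; have h0 : 0 < h by rewrite divr_gt0.
have close u v : u <= v <= u + h -> `|v - u| < e.
  move=> /andP[uv vuh]; rewrite ger0_norm ?subr_ge0 // ltrBlDl.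
  by apply: le_lt_trans vuh _; rewrite ltrD2l /h ltr_pdivrMr // ltr_pMr // ltr1n.
have boxU s t : x i <= s <= x i + h -> x j <= t <= x j + h ->
    U (move i (move j x t) s).
  by move=> /close sI /close tI; have [] := eP s t sI tI.
have [s [t [sI tI D1]]] := mixed_difference ij oU Cf h0 boxU.
have [|t' [s' [tI' sI' D2]]] := @mixed_difference j i f U x h ji oU Cf h0.
  by move=> t' s' tI' sI'; rewrite -(move_comm _ _ _ ij); apply: boxU.
rewrite -!(move_comm _ _ _ ij) in D2.
set p := move i (move j x t) s in D1; set q := move i (move j x t') s' in D2.
have eq_pq : partial j (partial i f) p = partial i (partial j f) q.
  have h_neq0 : h != 0 by rewrite gt_eqF.
  have cancel (A B X Y : R) : X = A * h * h -> Y = B * h * h -> X = Y -> A = B.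
    by move=> -> -> /(mulIf h_neq0)/(mulIf h_neq0).
  apply: cancel D1 D2 _.
  by rewrite !opprB [LHS]addrACA [RHS]addrACA; congr (_ + _); rewrite addrC.
have lt_le (u v : R) : u < v < u + h -> `|v - u| < e.
  by move=> /andP[/ltW uv /ltW vu]; apply: close; rewrite uv.
have [_ [p1 _]] := eP s t (lt_le _ _ sI) (lt_le _ _ tI).
have [_ [_ q1]] := eP s' t' (lt_le _ _ sI') (lt_le _ _ tI').
have near_eq (A B C D e' : R) :
    `|A - C| < e' / 2 -> `|B - D| < e' / 2 -> C = D -> `|A - B| < e'.
  move=> AC BD CD; have -> : A - B = (A - C) - (B - D).
    by rewrite CD opprB addrA subrK.
  apply: le_lt_trans (ler_normB _ _) _.
  rewrite [X in _ < X](splitr e').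
  exact: ltrD.
have := near_eq _ _ _ _ _ q1 p1 (esym eq_pq).
by rewrite ltxx.
Qed.

End Schwarz.

(** * The local ring of germs *)

Lemma class_CV (R : realType) k U (f : Rinfty R -> R) : open U ->
  (forall x, U x -> f x != 0) -> class_C k U f ->
  class_C k U (fun x => (f x)^-1).
Proof.
move=> oU f0; elim: k f f0 => [|k IH] f f0 Cf.
  by have [cf _] := Cf; split=> // x Ux; apply: continuousV; [apply: f0|apply: cf].
have [cf df] := Cf; split.
  by move=> x Ux; apply: continuousV; [apply: f0 | apply: cf].
have Vf := IH _ f0 (class_CW Cf).
move=> i; have [dfi Cfi] := df i; split.
  move=> x Ux; apply: derivableV; last exact: dfi.
  by rewrite move_id f0.
pose g : Rinfty R -> R :=
  (fun=> 0) - (fun x => (f x)^-1) * (fun x => (f x)^-1) * partial i f.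
apply: (@class_C_eq _ _ _ g) => //.
  move=> x Ux; rewrite /g /partial [in RHS]derive1E.
  have -> : line i (fun x => (f x)^-1) x = fun t => (line i f x t)^-1 by [].
  rewrite deriveV; [|by rewrite line_id f0|exact: dfi].
  rewrite line_id -derive1E -[LHS]/(0 - (f x)^-1 * (f x)^-1 * partial i f x).
  by rewrite sub0r scaleNr expr2 invfM.
apply: class_CB => //; first exact: class_C_cst.
by apply: class_CM => //; apply: class_CM.
Qed.

Section GermRing.
Variables (R : realType) (P : Rinfty R).
Local Notation F := (germ P).
Implicit Types (f g : smooth P).

Lemma pi_eqP f g : \pi_F f = \pi_F g <-> \forall x \near P, f x = g x.
Proof.
split=> [/eqP|fg].
  rewrite -Quotient.idealrBE => /asboolP; apply: filterS => x.
  by rewrite -[X in X = _]/(f x - g x) => /eqP; rewrite subr_eq0 => /eqP.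
apply/eqP; rewrite -Quotient.idealrBE; apply/asboolP.
by apply: filterS fg => x fg; rewrite -[LHS]/(f x - g x) fg subrr.
Qed.

Lemma germP (Q : F -> Prop) : (forall f, Q (\pi_F f)) -> forall a, Q a.
Proof. by move=> Qpi a; rewrite -[a]reprK. Qed.

Lemma smooth_atP f : smooth_at P f.
Proof. by apply/asboolP; apply: smoothP. Qed.

Lemma piB f g : \pi_F f - \pi_F g = \pi_F (f - g).
Proof. by rewrite rmorphB. Qed.
Lemma piM f g : \pi_F f * \pi_F g = \pi_F (f * g).
Proof. by rewrite rmorphM. Qed.

Definition ev (a : F) : R := repr a P.

Lemma ev_pi f : ev (\pi_F f) = f P.
Proof.
have /pi_eqP/nbhs_singleton := reprK (\pi_F f); exact.
Qed.

Fact ev_zmod : zmod_morphism ev.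
Proof.
by elim/germP=> f; elim/germP=> g; rewrite piB !ev_pi.
Qed.

Fact ev_monoid : monoid_morphism ev.
Proof.
split; first by rewrite -(rmorph1 (\pi_F)) ev_pi.
by elim/germP=> f; elim/germP=> g; rewrite piM !ev_pi.
Qed.

HB.instance Definition _ := GRing.isZmodMorphism.Build F R ev ev_zmod.
HB.instance Definition _ := GRing.isMonoidMorphism.Build F R ev ev_monoid.

Lemma cst_is_smooth (c : R) : (fun _ : Rinfty R => c) \in is_smooth P.
Proof. by apply/asboolP; apply: smooth_at_cst. Qed.

Definition cst (c : R) : F := \pi_F (Smooth (cst_is_smooth c)).

Fact cst_zmod : zmod_morphism cst.
Proof.
by move=> c d; rewrite /cst piB; apply/pi_eqP; apply: filterE => x.
Qed.

Fact cst_monoid : monoid_morphism cst.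
Proof.
split; first by rewrite -(rmorph1 (\pi_F)); apply/pi_eqP; apply: filterE => x.
by move=> c d; rewrite /cst piM; apply/pi_eqP; apply: filterE => x.
Qed.

HB.instance Definition _ := GRing.isZmodMorphism.Build R F cst cst_zmod.
HB.instance Definition _ := GRing.isMonoidMorphism.Build R F cst cst_monoid.

Lemma evK : cancel cst ev.
Proof. by move=> c; rewrite /cst ev_pi. Qed.

(** The reciprocal is smooth on the open set where the function does not
    vanish, and depends on the same coordinates. *)
Lemma germ_unit (a : F) : ev a != 0 -> exists b, b * a = 1.
Proof.
elim/germP: a => f; rewrite ev_pi => fP0.
have [U [[oU UP] Cf [m fm]]] := smooth_atP f.
pose W := U `&` [set x | f x != 0].
have oW : open W.
  rewrite openE => x [Ux fx0].
  have [cf _] := Cf 0%N.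
  apply: filterI; first by apply: open_nbhs_nbhs; split.
  have : nbhs (f x) [set y : R | y != 0].
    apply: open_nbhs_nbhs; split=> //; exact: open_neq.
  exact: cf.
have sV : (fun x => (f x)^-1) \in is_smooth P.
  apply/asboolP; exists W; split; first by split.
    move=> k; apply: class_CV => //; first by move=> x [].
    by apply: class_C_subset (Cf k) => x [].
  by exists m => x y [Ux _] [Uy _] xy; rewrite (fm x y).
exists (\pi_F (Smooth sV)); rewrite piM -(rmorph1 (\pi_F)); apply/pi_eqP.
have : nbhs P W by apply: open_nbhs_nbhs; split.
by apply: filterS => x [_ fx0]; rewrite -[LHS]/((f x)^-1 * f x) mulVf.
Qed.

Lemma germ_partialB i (a b : F) :
  germ_partial i (a - b) = germ_partial i a - germ_partial i b.
Proof.
elim/germP: a => f; elim/germP: b => g; rewrite piB !germ_partial_pi piB.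
apply/pi_eqP.
have [U [m [[oU UP] Cf Cg _]]] := smooth_atI (smooth_atP f) (smooth_atP g).
have [_ /(_ i)[df _]] := Cf 1%N; have [_ /(_ i)[dg _]] := Cg 1%N.
have : nbhs P U by apply: open_nbhs_nbhs; split.
apply: filterS => x Ux.
rewrite -[RHS]/(partial i f x - partial i g x) /= /partial !derive1E.
by rewrite -deriveB; [|apply: df|apply: dg].
Qed.

Lemma germ_partialM i (a b : F) :
  germ_partial i (a * b) = germ_partial i a * b + a * germ_partial i b.
Proof.
elim/germP: a => f; elim/germP: b => g; rewrite piM !germ_partial_pi !piM -rmorphD.
apply/pi_eqP.
have [U [m [[oU UP] Cf Cg _]]] := smooth_atI (smooth_atP f) (smooth_atP g).
have [_ /(_ i)[df _]] := Cf 1%N; have [_ /(_ i)[dg _]] := Cg 1%N.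
have : nbhs P U by apply: open_nbhs_nbhs; split.
apply: filterS => x Ux.
rewrite -[RHS]/(partial i f x * g x + f x * partial i g x) /= /partial !derive1E.
have -> : line i (f * g) x = line i f x * line i g x by [].
rewrite deriveM; [|exact: df|exact: dg].
by rewrite !line_id addrC; congr (_ + _); rewrite mulrC.
Qed.

Lemma germ_partialC i j (a : F) :
  germ_partial i (germ_partial j a) = germ_partial j (germ_partial i a).
Proof.
elim/germP: a => f; rewrite !germ_partial_pi; apply/pi_eqP.
have [U [[oU UP] Cf _]] := smooth_atP f.
have : nbhs P U by apply: open_nbhs_nbhs; split.
by apply: filterS => x Ux; apply: schwarz oU Ux (Cf 2%N).
Qed.

(** A function is constant along a coordinate on which it does not depend. *)
Lemma germ_partial_finite (a : F) :
  exists m, forall i, (m <= i)%N -> germ_partial i a = 0.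
Proof.
elim/germP: a => f; have [U [[oU UP] Cf [m fm]]] := smooth_atP f.
exists m => i mi; rewrite germ_partial_pi -(rmorph0 (\pi_F)); apply/pi_eqP.
have : nbhs P U by apply: open_nbhs_nbhs; split.
apply: filterS => x Ux; rewrite -[RHS]/(0 : R) /= /partial derive1E.
rewrite -(derive_cst (f x) (x i) 1); apply: near_eq_derive.
apply: filterS (line_nbhs i oU Ux) => t Ut; apply: fm => // j jm.
by rewrite move_other // gtn_eqF // (leq_trans jm).
Qed.

Lemma germ_partial_cst i (c : R) : germ_partial i (cst c) = 0.
Proof.
rewrite germ_partial_pi -(rmorph0 (\pi_F)); apply/pi_eqP; apply: filterE => x.
by rewrite -[RHS]/(0 : R) /= /partial derive1E derive_cst.
Qed.

End GermRing.

(** * Lie derivatives of forms *)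

Section LieCalculus.
Variables (R : realType) (P : Rinfty R).
Local Notation F := (germ P).
Implicit Types (a b f : F) (u v w : one_form P) (Z W : vector_field P).

Lemma germ_partial0 i : germ_partial i (0 : F) = 0.
Proof. by have := @germ_partialB R P i 0 0; rewrite !subrr. Qed.

Lemma germ_partialD i a b :
  germ_partial i (a + b) = germ_partial i a + germ_partial i b.
Proof.
by rewrite -[b in LHS]opprK germ_partialB -[- b]sub0r germ_partialB
  germ_partial0 sub0r opprK.
Qed.

Lemma germ_partial_sum i I (r : seq I) (Q : pred I) (g : I -> F) :
  germ_partial i (\sum_(k <- r | Q k) g k) =
  \sum_(k <- r | Q k) germ_partial i (g k).
Proof. exact: (big_morph _ (germ_partialD i) (germ_partial0 i)). Qed.

(** Two forms can only be compared over a common range of indices. *)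
Lemma contraction_widen N w Z : (size w <= N)%N ->
  contraction w Z = \sum_(i < N) w`_i * Z i.
Proof.
move=> wN; rewrite /contraction (big_ord_widen N (fun i => w`_i * Z i)) //.
rewrite big_mkcond; apply: eq_bigr => i _.
by case: ltnP => // iw; rewrite nth_default // mul0r.
Qed.

Lemma contraction_linear Z : linear_for *%R ((contraction (P := P))^~ Z).
Proof.
move=> a u v; set N := maxn (size u) (size v).
rewrite !(@contraction_widen N) ?leq_maxl ?leq_maxr //; last first.
  rewrite (leq_trans (size_polyD _ _)) // geq_max leq_maxr andbT.
  by rewrite (leq_trans (size_scale_leq _ _)) // leq_maxl.
rewrite mulr_sumr -big_split; apply: eq_bigr => i _.
by rewrite coefD coefZ mulrDl mulrA.
Qed.

Lemma contractionD Z u v : contraction (u + v) Z = contraction u Z + contraction v Z.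
Proof. by have := contraction_linear Z 1 u v; rewrite scale1r mul1r. Qed.

Lemma contraction0 Z : contraction 0 Z = 0 :> F.
Proof. by rewrite /contraction size_poly0 big_ord0. Qed.

Lemma contractionZ Z a u : contraction (a *: u) Z = a * contraction u Z.
Proof. by have := contraction_linear Z a u 0; rewrite !addr0 contraction0 addr0. Qed.

Lemma contractionB Z u v : contraction (u - v) Z = contraction u Z - contraction v Z.
Proof. by rewrite contractionD -scaleN1r contractionZ mulN1r. Qed.

Lemma contraction_sum Z I (r : seq I) (Q : pred I) (g : I -> one_form P) :
  contraction (\sum_(k <- r | Q k) g k) Z =
  \sum_(k <- r | Q k) contraction (g k) Z.
Proof. exact: (big_morph _ (contractionD Z) (contraction0 Z)). Qed.

Lemma contraction_dh Z i : contraction (dh P i) Z = Z i :> F.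
Proof.
rewrite (@contraction_widen i.+1) ?size_polyXn // (bigD1 ord_max) //= coefXn eqxx.
rewrite mul1r big1 ?addr0 // => j /negPf ji.
by rewrite coefXn -[_ == i]/(_ == ord_max :> nat) val_eqE ji mul0r.
Qed.

Lemma contraction_vectorD u Z W :
  contraction u (Z + W) = contraction u Z + contraction u W :> F.
Proof. by rewrite -big_split; apply: eq_bigr => i _; apply: mulrDr. Qed.

Lemma contraction_vectorZ u a Z : contraction u (a *: Z) = a * contraction u Z :> F.
Proof. by rewrite mulr_sumr; apply: eq_bigr => i _; apply: mulrCA. Qed.

Lemma contraction_vector0 u : contraction u (0 : vector_field P) = 0 :> F.
Proof. by rewrite /contraction big1 // => i _; apply: mulr0. Qed.

Lemma contraction_vector_sum u I (r : seq I) (Q : pred I)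
    (X : I -> vector_field P) :
  contraction u (\sum_(k <- r | Q k) X k) =
  \sum_(k <- r | Q k) contraction u (X k) :> F.
Proof.
exact: (big_morph _ (contraction_vectorD u) (contraction_vector0 u)).
Qed.

Lemma coef_differential f k : (differential f)`_k = germ_partial k f.
Proof.
have [m m0] := germ_partial_finite f.
rewrite /differential -(fsbig_widen `I_m) //=; last first.
  move=> i [_ /=] /negP; rewrite -leqNgt => /m0 ->; exact: scale0r.
rewrite -fsbig_ord coef_sum.
have [km|mk] := ltnP k m.
  rewrite (bigD1 (Ordinal km)) //= coefZ coefXn eqxx mulr1 big1 ?addr0 // => j jk.
  rewrite coefZ coefXn; move: jk; rewrite -val_eqE /= eq_sym => /negPf ->.
  by rewrite mulr0.
rewrite m0 // big1 // => j _; rewrite coefZ coefXn gtn_eqF ?mulr0 //.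
exact: leq_trans (ltn_ord j) mk.
Qed.

Lemma differentialD a b : differential (a + b) = differential a + differential b.
Proof. by apply/polyP => k; rewrite coefD !coef_differential germ_partialD. Qed.

Lemma differentialB a b : differential (a - b) = differential a - differential b.
Proof. by apply/polyP => k; rewrite coefB !coef_differential germ_partialB. Qed.

Lemma differentialM a b :
  differential (a * b) = a *: differential b + b *: differential a.
Proof.
apply/polyP => k; rewrite coefD !coefZ !coef_differential germ_partialM addrC.
by rewrite [b * _]mulrC.
Qed.

Lemma differential_cst (c : R) : differential (cst P c) = 0.
Proof. by apply/polyP => k; rewrite coef_differential germ_partial_cst coef0. Qed.

Lemma lie_functionD Z a b :
  lie_function Z (a + b) = lie_function Z a + lie_function Z b.
Proof. by rewrite /lie_function differentialD contractionD. Qed.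

Lemma lie_function0 Z : lie_function Z (0 : F) = 0.
Proof. by apply: (addrI (lie_function Z 0)); rewrite -lie_functionD !addr0. Qed.

Lemma lie_function_sum Z I (r : seq I) (Q : pred I) (g : I -> F) :
  lie_function Z (\sum_(k <- r | Q k) g k) =
  \sum_(k <- r | Q k) lie_function Z (g k).
Proof. exact: (big_morph _ (lie_functionD Z) (lie_function0 Z)). Qed.

Lemma lie_functionM Z a b :
  lie_function Z (a * b) = a * lie_function Z b + b * lie_function Z a.
Proof. by rewrite /lie_function differentialM contractionD !contractionZ. Qed.

Lemma lie_widen N Z w : (size w <= N)%N ->
  lie Z w =
  \sum_(i < N) (lie_function Z w`_i *: dh P i + w`_i *: differential (Z i)).
Proof.
move=> wN; rewrite /lie.
rewrite (big_ord_widen N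
  (fun i => lie_function Z w`_i *: dh P i + w`_i *: differential (Z i))) //.
rewrite big_mkcond; apply: eq_bigr => i _.
by case: ltnP => // iw; rewrite nth_default // lie_function0 !scale0r addr0.
Qed.

Lemma lieD Z u v : lie Z (u + v) = lie Z u + lie Z v.
Proof.
set N := maxn (size u) (size v).
rewrite !(@lie_widen N) ?leq_maxl ?leq_maxr ?size_polyD //.
rewrite -big_split; apply: eq_bigr => i _.
by rewrite coefD lie_functionD !scalerDl addrACA.
Qed.

Lemma lie0 Z : lie Z 0 = 0.
Proof. by rewrite /lie size_poly0 big_ord0. Qed.

Lemma form_widen w : w = \sum_(i < size w) w`_i *: dh P i.
Proof. by rewrite -[LHS]coefK poly_def. Qed.

Lemma lieZ Z a w : lie Z (a *: w) = a *: lie Z w + lie_function Z a *: w.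
Proof.
rewrite (@lie_widen (size w)) ?size_scale_leq //.
rewrite [in X in _ + X](form_widen w) !scaler_sumr -big_split.
apply: eq_bigr => i _ /=.
rewrite coefZ lie_functionM scalerDl scalerDr !scalerA addrAC.
by rewrite [_`_i * _]mulrC.
Qed.

Lemma lie_dh Z i : lie Z (dh P i) = differential (Z i).
Proof.
rewrite (@lie_widen i.+1) ?size_polyXn // (bigD1 ord_max) //= big1 => [|j ji].
  rewrite coefXn eqxx scale1r addr0 -(rmorph1 (cst P)).
  by rewrite /lie_function differential_cst contraction0 scale0r add0r.
have -> : (dh P i)`_j = 0.
  by rewrite coefXn -[_ == i]/(_ == ord_max :> nat) val_eqE (negPf ji).
by rewrite lie_function0 !scale0r addr0.
Qed.

Definition bracket Z W : vector_field P :=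
  fun i => lie_function Z (W i) - lie_function W (Z i).

(** On a dh^i the two sides are Z(a) W^i + a W(Z^i), because d(Z^i) contracted
    with W is W(Z^i). *)
Lemma contraction_lie Z W w :
  contraction (lie Z w) W =
  lie_function Z (contraction w W) - contraction w (bracket Z W).
Proof.
rewrite [LHS]contraction_sum lie_function_sum -sumrB; apply: eq_bigr => i _.
rewrite contractionD !contractionZ contraction_dh -/(lie_function W (Z i)).
rewrite lie_functionM mulrBr opprB [RHS]addrC [RHS]addrA subrK [RHS]addrC.
by rewrite [lie_function Z _ * _]mulrC.
Qed.

Lemma coef_lie Z w k : (lie Z w)`_k =
  lie_function Z w`_k + \sum_(i < size w) w`_i * germ_partial k (Z i).
Proof.
rewrite /lie big_split coefD /=; congr (_ + _).
  rewrite -(poly_def _ (fun i => lie_function Z w`_i)) coef_poly.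
  by case: ltnP => // kw; rewrite nth_default // lie_function0.
by rewrite coef_sum; apply: eq_bigr => i _; rewrite coefZ coef_differential.
Qed.

(** This is where the symmetry of second derivatives enters. *)
Lemma lie_differential Z f :
  lie Z (differential f) = differential (lie_function Z f).
Proof.
apply/polyP => k; rewrite coef_lie !coef_differential.
set N := size (differential f).
have wN : (size (differential (germ_partial k f)) <= N)%N.
  apply/leq_sizeP => j Nj; rewrite coef_differential germ_partialC.
  have -> : germ_partial j f = 0 by rewrite -coef_differential nth_default.
  exact: germ_partial0.
rewrite {1}/lie_function (contraction_widen _ wN) -big_split /lie_function.
rewrite /contraction germ_partial_sum; apply: eq_bigr => i _.
by rewrite !coef_differential germ_partialM /= germ_partialC.
Qed.

(** The previous two lemmas, for the form df. *)
Lemma lie_bracket_function Z W f : lie_function (bracket Z W) f =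
  lie_function Z (lie_function W f) - lie_function W (lie_function Z f).
Proof.
have := contraction_lie Z W (differential f); rewrite lie_differential.
rewrite -!/(lie_function _ _) => ->.
by rewrite opprB addrC subrK.
Qed.

(** Both sides are additive, and on a dh^i everything is computed from the
    Leibniz rule and the commutation with d. *)
Lemma lie_bracket Z W w :
  lie Z (lie W w) - lie W (lie Z w) = lie (bracket Z W) w.
Proof.
rewrite (form_widen w).
apply: (big_ind (fun u => lie Z (lie W u) - lie W (lie Z u) =
                          lie (bracket Z W) u)) => [|u v Du Dv|i _].
- by rewrite !lie0 subrr.
- by rewrite !lieD -Du -Dv opprD addrACA.
have lie2 (X Y : vector_field P) : lie X (lie Y (w`_i *: dh P i)) =
    (w`_i *: differential (lie_function X (Y i)) +
     lie_function X (lie_function Y w`_i) *: dh P i) +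
    (lie_function X w`_i *: differential (Y i) +
     lie_function Y w`_i *: differential (X i)).
  rewrite lieZ lie_dh lieD !lieZ lie_dh lie_differential.
  by rewrite [X in _ + X]addrC addrACA.
rewrite !lie2 [X in _ - (_ + X)]addrC opprD addrACA subrr addr0.
rewrite lieZ lie_dh /bracket differentialB lie_bracket_function.
by rewrite scalerBr scalerBl opprD addrACA.
Qed.

Lemma lie_vectorD Z W w : lie (Z + W) w = lie Z w + lie W w.
Proof.
rewrite -big_split; apply: eq_bigr => i _ /=.
rewrite {1}/lie_function contraction_vectorD scalerDl.
by rewrite -[(Z + W) i]/(Z i + W i) differentialD scalerDr addrACA.
Qed.

Lemma lie_vectorZ a Z w :
  lie (a *: Z) w = a *: lie Z w + contraction w Z *: differential a.
Proof.
rewrite scaler_sumr scaler_suml -big_split; apply: eq_bigr => i _ /=.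
rewrite {1}/lie_function contraction_vectorZ.
rewrite -[(a *: Z) i]/(a * Z i) differentialM !scalerDr !scalerA.
by rewrite addrA [_`_i * a]mulrC.
Qed.

End LieCalculus.

(** * The graded module of a diffiety *)

Section Diffiety.
Variables (R : realType) (P : Rinfty R) (n : nat).
Variables (Omega : set (one_form P)) (Omegas : nat -> set (one_form P)).
Local Notation F := (germ P).
Local Notation H := (annihilator Omega).
Implicit Types (X Y : vector_field P) (w v : one_form P).

Lemma annihilator_submodule : submodule H.
Proof.
apply/submoduleP; split=> [w _|a X Y HX HY w Ow].
  exact: contraction_vector0.
rewrite contraction_vectorD contraction_vectorZ.
by rewrite (HX w Ow) (HY w Ow) mulr0 addr0.
Qed.

Hypothesis subO : submodule Omega.

(** The coefficient of W_i at d/dh^k is the i-th coordinate of dh^k modulo Omega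
    in a basis of Phi / Omega, so that contracting a form with W_i gives its i-th
    coordinate modulo Omega. *)
Lemma exists_dual_basis : codimension Omega n ->
  exists W : 'I_n -> vector_field P, basis H W.
Proof.
move=> [e [_ span_e free_e]].
have [alpha alphaP] := choice (fun k => span_e (dh P k) I).
pose W i : vector_field P := fun k => alpha k i.
have coordW w : Omega (w - \sum_i contraction w (W i) *: e i).
  have WE i : contraction w (W i) = \sum_(k < size w) w`_k * alpha k i by [].
  have -> : \sum_i contraction w (W i) *: e i =
      \sum_(k < size w) w`_k *: (\sum_i alpha k i *: e i).
    under eq_bigr => i _ do rewrite WE scaler_suml.
    rewrite exchange_big; apply: eq_bigr => k _; rewrite scaler_sumr.
    by apply: eq_bigr => i _; rewrite scalerA.
  rewrite {1}(form_widen w) -sumrB; apply: (submodule_sum subO) => k _.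
  by rewrite -scalerBr; apply: submoduleZ.
have HW i : H (W i).
  move=> w Ow; apply: (free_e (fun i => contraction w (W i))).
  exact: submodule_modC (coordW w) Ow.
have dualW i j : contraction (e j) (W i) = (i == j)%:R.
  apply/eqP; rewrite eq_sym -subr_eq0; apply/eqP.
  apply: (free_e (fun i => (i == j)%:R - contraction (e j) (W i))).
  under eq_bigr => k _ do rewrite scalerBl.
  rewrite sumrB (bigD1 j) //= eqxx scale1r big1 ?addr0 => [|k /negPf->].
    exact: coordW.
  by rewrite scale0r.
exists W; split=> // [X HX|a].
  exists (fun i => contraction (e i) X); apply/eqP; rewrite subr_eq0; apply/eqP.
  apply/funext => k; rewrite fct_sumE -[LHS](contraction_dh X).
  have /eqP := HX _ (coordW (dh P k)); rewrite contractionB subr_eq0 => /eqP ->.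
  rewrite contraction_sum; apply: eq_bigr => i _.
  by rewrite contractionZ contraction_dh; apply: mulrC.
move=> Wa j; have := congr1 (contraction (e j)) (Wa : _ = 0).
rewrite contraction_vector0 contraction_vector_sum (bigD1 j) //=.
rewrite contraction_vectorZ dualW eqxx mulr1 big1 ?addr0 // => i /negPf ij.
by rewrite contraction_vectorZ dualW ij mulr0.
Qed.

(** L_X w is in Omega, so that its contraction with Y vanishes, as does the
    contraction of w. *)
Lemma bracket_annihilator X Y :
  (forall w, Omega w -> Omega (lie X w)) -> H X -> H Y -> H (bracket X Y).
Proof.
move=> OX HX HY w Ow; have := contraction_lie X Y w.
rewrite (HY _ (OX w Ow)) (HY w Ow) lie_function0 sub0r => /eqP.
by rewrite eq_sym oppr_eq0 => /eqP.
Qed.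

Hypothesis good : good_filtration Omega Omegas.

Lemma filtration_submodule l : submodule (Omegas l).
Proof. by have [/(_ l)[]] := good. Qed.

Lemma filtration_sub l : Omegas l `<=` Omega.
Proof. by have [_ _ -> _ _] := good; move=> w Ow; exists l. Qed.

Lemma filtration_lie l X w : H X -> Omegas l w -> Omegas l.+1 (lie X w).
Proof.
have [_ _ _ lieO _] := good; move=> HX Ow; apply: lieO.
by apply: sub_gen_smallest; exists X => //; exists w.
Qed.

Lemma previous_submodule l : submodule (previous Omegas l).
Proof.
case: l => [|l]; last exact: filtration_submodule.
by apply/submoduleP; split=> // a u v -> ->; rewrite scaler0 addr0.
Qed.

Lemma previous_sub l : previous Omegas l `<=` Omegas l.
Proof.
case: l => [w ->|l]; first exact: submodule0 (filtration_submodule 0).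
by have [_ up _ _ _] := good; apply: up.
Qed.

Lemma Omega_lie X w : H X -> Omega w -> Omega (lie X w).
Proof.
move=> HX; have [_ _ defO _ _] := good; rewrite {1}defO => -[l _ Ow].
exact: filtration_sub (filtration_lie HX Ow).
Qed.

Section Fields.
Variables (W : 'I_n -> vector_field P) (basisW : basis H W).

(** The constant combinations of the frame W: these depend on finitely many real
    parameters, which is what a general choice needs. *)
Definition frame_field (c : 'rV[R]_n) : vector_field P :=
  comb W (map_mx (cst P) c).

Definition act (c : 'rV[R]_n) w := lie (frame_field c) w.

Lemma frame_field_annihilator c : H (frame_field c).
Proof.
have [HW _ _] := basisW.
apply: (submodule_sum annihilator_submodule) => i _.
exact: submoduleZ annihilator_submodule _ _ (HW i).
Qed.

Lemma frame_field_linear k c d :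
  frame_field (k *: c + d) = cst P k *: frame_field c + frame_field d.
Proof.
have E : map_mx (cst P) (k *: c + d) =
    cst P k *: map_mx (cst P) c + map_mx (cst P) d.
  by apply/rowP => i; rewrite !mxE rmorphD rmorphM.
by rewrite /frame_field E combD combZ.
Qed.

Lemma frame_field_gen j : frame_field (coord_vec R j) = W j.
Proof. by rewrite /frame_field map_delta_mx comb_delta. Qed.

Lemma lie_comb (a : 'rV[F]_n) w : Omega w ->
  lie (comb W a) w = \sum_i a 0 i *: lie (W i) w.
Proof.
move=> Ow; have [HW _ _] := basisW.
have lieE X : H X -> forall b, lie (b *: X) w = b *: lie X w.
  by move=> HX b; rewrite lie_vectorZ (HX w Ow) scale0r addr0.
rewrite (big_morph (fun X => lie X w) (fun X Y => lie_vectorD X Y w) (id1 := 0)).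
  by apply: eq_bigr => i _; apply: lieE.
have := lieE 0 (submodule0 annihilator_submodule) 0.
by rewrite !scale0r.
Qed.

(** All defects are forms in the preceding step of the filtration: Z(a) w for the
    linearity, and L_[Z,W] w for the commutation. *)
Lemma graded_module_filtration :
  graded_module (cst P) Omegas (previous Omegas) act.
Proof.
split.
- exact: filtration_submodule.
- exact: previous_submodule.
- exact: previous_sub.
- by move=> l c w; apply: filtration_lie (frame_field_annihilator c).
- move=> [|l] c w; last exact: filtration_lie (frame_field_annihilator c).
  by move=> ->; rewrite /act lie0; apply: submodule0 (filtration_submodule 0).
- by move=> c u v; apply: lieD.
- move=> l c a w Ow; rewrite /act lieZ addrC addKr.
  exact: submoduleZ (filtration_submodule l) _ _ Ow.
- move=> l c d w Ow; rewrite /act lie_bracket; apply: filtration_lie Ow.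
  apply: bracket_annihilator; try exact: frame_field_annihilator.
  by move=> v; apply: Omega_lie; apply: frame_field_annihilator.
- move=> l k c d w Ow; rewrite /act frame_field_linear lie_vectorD lie_vectorZ.
  rewrite (frame_field_annihilator c (filtration_sub Ow)) scale0r addr0 subrr.
  exact: submodule0 (previous_submodule _).
Qed.

Lemma graded_fg_filtration : graded_fg Omegas (previous Omegas) act.
Proof.
have gm := graded_module_filtration.
have [_ _ _ _ [l0 l0P]] := good; exists l0 => l /l0P <- _ [u Ou [v Lv <-]].
have sO := filtration_submodule l.
have sS : submodule (sum_images predT (fun j : 'I_n => act (coord_vec R j))
    (Omegas l) (previous Omegas l.+1)).
  by apply: (images_submodule gm predT (fun j => coord_vec R j) (N := Omegas)).
apply: (submoduleD sS).
  by apply: (images_base gm predT (fun j => coord_vec R j) (N := Omegas)).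
move: v Lv; apply: smallest_sub => // _ [X HX [w Ow <-]].
have [_ spanW _] := quotient_basis_comb annihilator_submodule basisW.
have [a /eqP] := spanW X HX; rewrite subr_eq0 => /eqP ->.
rewrite (lie_comb a (filtration_sub Ow)); apply: (submodule_sum sS) => i _.
apply: submoduleZ sS _ _ _; rewrite -frame_field_gen.
by apply: (images_image gm (fun j => coord_vec R j) (N := Omegas)).
Qed.

Lemma basis_change (g : 'I_n -> 'rV[R]_n) : row_free (\matrix_i g i) ->
  basis H (fun i => frame_field (g i)).
Proof.
move=> freeg; set G := \matrix_i g i in freeg.
have uG : G \in unitmx by rewrite -row_free_unit.
pose G' := map_mx (cst P) G; pose Gi := map_mx (cst P) (invmx G).
have GGi : G' *m Gi = 1%:M by rewrite -map_mxM mulmxV // map_mx1.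
have GiG : Gi *m G' = 1%:M by rewrite -map_mxM mulVmx // map_mx1.
have frame_fieldE b : comb (fun i => frame_field (g i)) b = comb W (b *m G').
  rewrite comb_mul; congr comb; apply/funext => i.
  by rewrite /frame_field /G' -map_row rowK.
have [HW spanW freeW] := quotient_basis_comb annihilator_submodule basisW.
apply: basis_comb => [i|X /spanW[a aX]|a].
- exact: frame_field_annihilator.
- by exists (a *m Gi); rewrite frame_fieldE -mulmxA GiG mulmx1.
- rewrite frame_fieldE => /freeW aG.
  by rewrite -[a]mulmx1 -GGi mulmxA aG mul0mx.
Qed.

Lemma act_sub_stable N X l w : graded_sub Omegas (previous Omegas) act N ->
  H X -> N l w -> N l.+1 (lie X w).
Proof.
move=> sN HX Nw; have Ow := filtration_sub (sub_top sN Nw).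
have [_ spanW _] := quotient_basis_comb annihilator_submodule basisW.
have [a /eqP] := spanW X HX; rewrite subr_eq0 => /eqP ->.
rewrite lie_comb //; apply: (submodule_sum (sub_submodule sN _)) => i _.
apply: submoduleZ (sub_submodule sN _) _ _ _; rewrite -frame_field_gen.
exact: (sub_stable sN).
Qed.

Lemma graded_coverP N (u : nat -> one_form P) :
  graded_cover N u <-> (exists m, forall l, (m <= l)%N -> u l = 0) /\
                       forall l, N l (u l).
Proof.
split=> [[fu Nu]|[[m um] Nu]]; split=> //.
  have [s us] := (finite_seqP _).1 fu.
  exists (\max_(k <- s) k).+1 => l; rewrite ltnNge => /negP ml.
  apply: contrapT => /eqP ul; apply: ml.
  have : [set l | u l != 0] l by [].
  by rewrite us => /= sl; exact: (@leq_bigmax_seq _ s xpredT id l sl).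
apply: (@sub_finite_set _ _ `I_m) => [l /= ul|]; last exact: finite_II.
by rewrite ltnNge; apply/negP => /um ul0; rewrite ul0 eqxx in ul.
Qed.

Lemma graded_cover_submodule N : (forall l, submodule (N l)) ->
  submodule (graded_cover N : set (nat -> one_form P)).
Proof.
move=> sN; apply/submoduleP; split.
  by apply/graded_coverP; split=> [|l]; [exists 0%N | apply: submodule0].
move=> a u v /graded_coverP[[m um] Nu] /graded_coverP[[m' vm] Nv].
apply/graded_coverP; split=> [|l]; last exact: submoduleZD.
exists (maxn m m') => l; rewrite geq_max => /andP[ml ml'].
by rewrite -[LHS]/(a *: u l + v l) um // vm // scaler0 addr0.
Qed.

(** The right-hand side only uses the generators Z_1, ..., Z_i applied to M in
    degree l - 1; it is stable under all of H because the actions commute. *)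
Lemma A_ideal_mulP (g : 'I_n -> 'rV[R]_n) (i l : nat) w :
  A_ideal_mul H Omegas (fun j => frame_field (g j)) i (homogeneous l w) <->
  add_images Omegas act (fun j : 'I_n => (j < i)%N) g (previous Omegas) l w.
Proof.
have gm := graded_module_filtration.
set A := add_images _ _ _ _ _.
have sA : graded_sub Omegas (previous Omegas) act A.
  exact: (graded_sub_add_images gm _ _ (graded_sub_base gm)).
have AM := sub_top sA; have BA := sub_base sA; have sAl := sub_submodule sA.
split.
  suff: A_ideal_mul H Omegas (fun j => frame_field (g j)) i `<=` graded_cover A.
    move=> sub /sub/graded_coverP[_ /(_ l)].
    by rewrite /homogeneous eqxx.
  apply: smallest_sub.
    split; first exact: graded_cover_submodule.
    - move=> u /graded_coverP[fu Bu]; apply/graded_coverP; split=> // k.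
      exact: BA.
    - move=> u /graded_coverP[fu Au]; apply/graded_coverP; split=> // k.
      exact: AM.
    - move=> X u HX /graded_coverP[[m um] Au]; apply/graded_coverP; split.
        by exists m.+1 => -[//|k] /um /= ->; rewrite lie0.
      move=> [|k] /=; first exact: (submodule0 (sAl 0%N)).
      exact: (act_sub_stable sA HX (Au k)).
  move=> _ [j [u [ji /graded_coverP[[m um] Mu] ->]]]; apply/graded_coverP; split.
    by exists m.+1 => -[//|k] /um /= ->; rewrite lie0.
  move=> [|k] /=; first exact: (submodule0 (sAl 0%N)).
  exact: (images_image gm g (filtration_submodule k) (previous_submodule k.+1)
            ji (Mu k)).
have homD k u v : homogeneous k (u + v) = homogeneous k u + homogeneous k v
    :> (nat -> one_form P).
  apply/funext => k'; rewrite -[RHS]/(homogeneous k u k' + homogeneous k v k').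
  by rewrite /homogeneous; case: eqP => // _; rewrite addr0.
have hom0 k : homogeneous k 0 = 0 :> (nat -> one_form P).
  by apply/funext => k'; rewrite /homogeneous; case: eqP.
have hom_cover (N : nat -> set (one_form P)) k u :
    (forall l, submodule (N l)) -> N k u ->
    graded_cover N (homogeneous k u).
  move=> sN Nu; apply/graded_coverP; split.
    by exists k.+1 => k' kk'; rewrite /homogeneous gtn_eqF.
  by move=> k'; rewrite /homogeneous; case: eqP => [->|_] //; apply: submodule0.
move=> Aw X [[sX nullX _ _] genX].
case: l Aw => [w0|l [p Mp Bp]].
  by apply: nullX; apply: hom_cover => //; exact: previous_submodule.
rewrite -(subrK (\sum_(j < n | (j < i)%N) act (g j) (p j)) w) homD.
apply: (submoduleD sX).
  by apply: nullX; apply: hom_cover => //; exact: previous_submodule.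
rewrite (big_morph _ (homD l.+1) (hom0 l.+1)); apply: (submodule_sum sX) => j ji.
apply: genX; exists j, (homogeneous l (p j)); split=> //.
  by apply: hom_cover => //; exact: filtration_submodule.
apply/funext => -[|k] //=; rewrite /homogeneous eqSS.
by case: eqP => // _; rewrite lie0.
Qed.

End Fields.
End Diffiety.

Theorem theorem4p3 (R : realType) (P : Rinfty R) (n : nat)
    (Omega : set (one_form P)) (Omegas : nat -> set (one_form P))
    (n_gt0 : (0 < n)%N)
    (diffiety_Omega : diffiety n Omega)
    (good_Omegas : good_filtration Omega Omegas)
    (free_Omegas : free_components Omegas) :
  exists Z : 'I_n -> vector_field P, ordinary_basis Omega Omegas Z.
Proof.
have [subO codimO _] := diffiety_Omega.
have [W basisW] := exists_dual_basis subO codimO.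
have gm := graded_module_filtration good_Omegas basisW.
have fg := graded_fg_filtration good_Omegas basisW.
have [g [freeg [l0 gP]]] :=
  exists_ordinary_basis (@evK R P) (@germ_unit R P) gm fg free_Omegas.
exists (fun i => frame_field W (g i)); split; first exact: basis_change.
exists l0 => l l0l i w w' Ow Ow' /(A_ideal_mulP good_Omegas basisW).
rewrite -(act_sub gm (g i)) => Aww'.
apply/(A_ideal_mulP good_Omegas basisW); apply: gP Aww' => //.
exact: submoduleB (filtration_submodule good_Omegas l) _ _ Ow Ow'.
Qed.
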